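(* The isometry group of the inverse Gaussian family (the space of parameters $(\mu,\lambda)$, $\mu,\lambda>0$, with its Fisher metric) is the infinite dihedral group $\mathbb{R}\ltimes\mathbb{Z}_2$ generated by the mappings $$(\mu^{-1/2},\lambda^{-2})\mapsto(\alpha\,\mu^{-1/2},\alpha\,\lambda^{-2})$$ for $\alpha>0$ and inversions in the $(x^1,x^2)$-coordinates around a circle centered at the origin, where $x^1=\mu^{-1/2}$ and $x^2=\lambda^{-2}$.
   Context: The inverse Gaussian family is the family of probability densities on $(0,\infty)$ $$f(\zeta\,|\,\lambda,\mu)=\sqrt{\frac{\lambda}{2\pi\zeta^3}}\,\exp\Big[-\frac{\lambda(\zeta-\mu)^2}{2\mu^2\zeta}\Big],$$ where $\lambda$ is the shape parameter and $\mu$ the mean. For a parametrized family of probability densities $p(\zeta|\theta)$, the Fisher metric is the Riemannian metric on the parameter space given by $g_{jk}(\theta)=\int\frac{\partial\log p(\zeta|\theta)}{\partial\theta^j}\frac{\partial\log p(\zeta|\theta)}{\partial\theta^k}\,p(\zeta|\theta)\,d\zeta$. Inversion around the circle of radius $r$ centered at the origin is the map $x\mapsto r^2x/|x|^2$.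
   Formalization: The coordinate x^2=λ^{-2} is replaced by x^2=(2λ)^{-1/2}, in the dilations and in the inversions: the printed dilation multiplies the dμ² term λ/μ³ of the Fisher metric by α^{3/2}, so it is no isometry for α≠1. *)

(* Defs.v *)
From HB Require Import structures.
From mathcomp Require Import all_boot all_order all_algebra.
From mathcomp Require Import all_classical all_reals all_analysis.

Set Implicit Arguments.
Unset Strict Implicit.
Unset Printing Implicit Defensive.

Import Order.TTheory GRing.Theory Num.Theory.
Import numFieldNormedType.Exports.

Local Open Scope classical_set_scope.
Local Open Scope ring_scope.

(* Generalized dihedral group V ><| Z_2 of an abelian group V: the pair
   (v, e) stands for v * s^e, where the involution s acts on V by v |-> - v. *)
Definition dihedral (V : zmodType) : Type := (V * bool)%type.

HB.instance Definition _ (V : zmodType) := Choice.on (dihedral V).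

Section DihedralGroup.
Variable V : zmodType.
Implicit Types x y z : dihedral V.

Definition dihedral_mul x y : dihedral V :=
  (x.1 + (if x.2 then - y.1 else y.1), x.2 (+) y.2).

Definition dihedral_one : dihedral V := (0, false).

Definition dihedral_inv x : dihedral V :=
  (if x.2 then x.1 else - x.1, x.2).

Fact dihedral_mulA : associative dihedral_mul.
Proof.
move=> [a []] [b []] [c d]; rewrite /dihedral_mul /=;
  by rewrite ?opprD ?opprK ?addrA ?addbA ?addbT ?addbF ?negbK.
Qed.

Fact dihedral_mul1 : left_id dihedral_one dihedral_mul.
Proof. by case=> a b; rewrite /dihedral_mul /= add0r. Qed.

Fact dihedral_mulr1 : right_id dihedral_one dihedral_mul.
Proof. by case=> a [] /=; rewrite /dihedral_mul /= ?oppr0 addr0. Qed.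

Fact dihedral_mulV : left_inverse dihedral_one dihedral_inv dihedral_mul.
Proof. by case=> a [] /=; rewrite /dihedral_mul /= ?addrN ?addNr. Qed.

Fact dihedral_mulrV : right_inverse dihedral_one dihedral_inv dihedral_mul.
Proof. by case=> a [] /=; rewrite /dihedral_mul /= ?addrN. Qed.

HB.instance Definition _ := isGroup.Build (dihedral V)
  dihedral_mulA dihedral_mul1 dihedral_mulr1 dihedral_mulV dihedral_mulrV.

End DihedralGroup.

(* The group of self-maps of T, under composition, generated by the maps in G
   (the maps in G are meant to be bijections). *)
Inductive generated_group (T : Type) (G : set (T -> T)) : set (T -> T) :=
| generated_in f : G f -> generated_group G f
| generated_id : generated_group G id
| generated_comp f g :
    generated_group G f -> generated_group G g -> generated_group G (f \o g)
| generated_inv f g :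
    cancel f g -> cancel g f -> generated_group G f -> generated_group G g.

Section Geometry.
Variable R : realType.

(* C^oo on a set A, meant to be open: every iterated directional derivative
   (including F itself) is differentiable, hence continuous, on A. *)
Definition smooth_on (V W : normedModType R) (A : set V) (F : V -> W) : Prop :=
  forall (s : seq V) (x : V), A x ->
    differentiable (foldr (fun v G => 'D_v G) F s) x.

(* The Riemannian manifold is an open set M of R^n with metric tensor g.
   [valLR 0 f] extends f : M -> M to R^n by 0; derivatives at points of the
   open set M do not see the extension.  In the library's row-vector
   convention the differential is u |-> u *m 'J F x, so the last clause reads
   g_(f x) (df u, df v) = g_x (u, v). *)
Definition riemannian_isometry n (M : set 'rV[R]_n) (g : 'rV[R]_n -> 'M[R]_n)
    (f : M -> M) : Prop :=
  exists h : M -> M,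
    [/\ cancel f h, cancel h f,
        smooth_on M (valLR 0 f), smooth_on M (valLR 0 h) &
        forall x : M,
          'J (valLR 0 f) (val x) *m g (val (f x)) *m ('J (valLR 0 f) (val x))^T
          = g (val x)].

(* Densities p theta on the sample space S with respect to Lebesgue measure. *)
Definition fisher_metric n (S : set R) (p : 'rV[R]_n -> R -> R)
    (theta : 'rV[R]_n) : 'M[R]_n :=
  \matrix_(j < n, k < n)
    (\int[lebesgue_measure]_(z in S)
      ('D_(delta_mx 0 j) (fun t => ln (p t z)) theta *
       'D_(delta_mx 0 k) (fun t => ln (p t z)) theta * p theta z))%R.

(* Inversion around the sphere of radius r centered at the origin.  The norm
   of the library on 'rV[R]_n is the sup norm, hence the explicit sum. *)
Definition inversion n (r : R) (x : 'rV[R]_n) : 'rV[R]_n :=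
  (r ^+ 2 / \sum_(i < n) x 0 i ^+ 2) *: x.

End Geometry.

Section InverseGaussian.
Variable R : realType.

(* A parameter is the row vector (mu, lambda). *)
Definition ig_mu (theta : 'rV[R]_2) : R := theta 0 0.
Definition ig_lambda (theta : 'rV[R]_2) : R := theta 0 1.

Definition ig_param : set 'rV[R]_2 :=
  [set theta | 0 < ig_mu theta /\ 0 < ig_lambda theta].

Definition ig_pdf (theta : 'rV[R]_2) (z : R) : R :=
  let mu := ig_mu theta in let lambda := ig_lambda theta in
  Num.sqrt (lambda / (2 * pi * z ^+ 3)) *
  expR (- (lambda * (z - mu) ^+ 2 / (2 * mu ^+ 2 * z))).

Definition ig_metric : 'rV[R]_2 -> 'M[R]_2 :=
  fisher_metric `]0, +oo[ ig_pdf.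

Definition ig_isometries : set (ig_param -> ig_param) :=
  riemannian_isometry ig_metric.

(* The coordinates x^1 = mu^(-1/2) and x^2 = (2 lambda)^(-1/2).  The Fisher
   metric is (lambda / mu^3) dmu^2 + dlambda^2 / (2 lambda^2), which is
   2 ((dx^1)^2 + (dx^2)^2) / (x^2)^2 in these coordinates.  The source prints
   x^2 = lambda^(-2), a misprint: for no dilation factor other than 1 is
   (mu^(-1/2), lambda^(-2)) |-> (a mu^(-1/2), a lambda^(-2)) an isometry.
   Among the coordinates c lambda^q, only q = -1/2 makes dilations isometries
   and only c = 2^(-1/2) makes inversions isometries. *)
Definition ig_coord (theta : ig_param) : 'rV[R]_2 :=
  \row_(i < 2) [:: ig_mu (val theta) `^ (- 2^-1);
                   (2 * ig_lambda (val theta)) `^ (- 2^-1)]`_i.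

Definition ig_dilations : set (ig_param -> ig_param) :=
  [set f | exists2 a : R, 0 < a &
     forall theta, ig_coord (f theta) = a *: ig_coord theta].

Definition ig_inversions : set (ig_param -> ig_param) :=
  [set f | exists2 r : R, 0 < r &
     forall theta, ig_coord (f theta) = inversion r (ig_coord theta)].

End InverseGaussian.

Arguments ig_param R : clear implicits.
Arguments ig_isometries R : clear implicits.
Arguments ig_dilations R : clear implicits.
Arguments ig_inversions R : clear implicits.

(* Main.v *)
Require Import Defs.
From HB Require Import structures.
From mathcomp Require Import all_boot all_order all_algebra.
From mathcomp Require Import all_classical all_reals all_analysis.
From mathcomp Require Import measurable_realfun ring lra.

Set Implicit Arguments.
Unset Strict Implicit.
Unset Printing Implicit Defensive.

Import Order.TTheory GRing.Theory Num.Theory.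
Import numFieldNormedType.Exports.

Local Open Scope classical_set_scope.
Local Open Scope ring_scope.

(** The Fisher metric is (lambda / mu^3) dmu^2 + dlambda^2 / (2 lambda^2)
    (ig_metricE).  In the coordinates x = mu^(-1/2), y = (2 lambda)^(-1/2) it is
    twice the hyperbolic metric (dx^2 + dy^2) / y^2 of the upper half-plane, so
    the parameter space is one of the two halves into which the geodesic x = 0
    cuts the hyperbolic plane.  An isometry of such a half preserves its
    boundary geodesic: it slides along it (a dilation) or flips it (an
    inversion).

    The metric.  For z = mu w^2, u = w - 1/w and v = w + 1/w, the density times
    dz is N(u) du - e^c N(v) dv for a centred Gaussian density N and a constant
    c, because v^2 = u^2 + 4.  As z runs over the half-line, u runs over the
    whole line, whereas v comes from +oo and returns to +oo.  The Fisher
    integrands are even polynomials in u against N(u) du and N(u) dv; the first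
    kind integrates to Gaussian moments and the second kind to 0
    (Rintegral_ig_integrand).

    Dilations and inversions are isometries.  Both multiply the parameter
    (mu, lambda) by a positive factor, which is constant for a dilation and
    proportional to the square of rho = 1/mu + 1/(2 lambda) = x^2 + y^2 for an
    inversion (ig_rescale).  These maps are Laurent polynomials, hence smooth,
    and their Jacobian can be written down (ig_rescale_isometry).

    There is no other isometry.  The function cosh d, for the hyperbolic
    distance d, is rational in the coordinates (cosh_dist).  An isometry f maps
    the geodesic from p to q to a curve of the same length, and a horocyclic
    (Busemann) function bounds the distance between the ends of that curve by
    its length (cosh_dist_curve); so f does not increase distances, nor does
    its inverse, and f preserves them.  In the hyperboloid model the slope x/y
    is a linear functional, namely a combination of the functions cosh d(., p_i)
    for three points p_i; hence x/y o f is again linear, of the same Lorentz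
    norm, and since it is positive on the whole parameter space it dominates
    x/y (isometry_slope_le).  Applied to the inverse too, this shows that f
    preserves x/y, that is, the distance to the boundary geodesic.  What is left
    is the position along that geodesic, log rho, on which f acts as an isometry
    of the real line: a translation or a reflection (isometry_rescale). *)

(** * Primitives of even polynomials against a centred Gaussian density *)

Section gauss.
Variable R : realType.
Variable s : R.
Hypothesis s_gt0 : 0 < s.
Let N := normal_pdf 0 s.

Lemma normal_pdf0E x : N x = normal_peak s * expR (- x ^+ 2 / (2 * s ^+ 2)).
Proof.
rewrite /N normal_pdfE ?gt_eqF// /normal_fun subr0 mulr_natl//.
Qed.

Lemma is_derive_normal_pdf0 (x : R) : is_derive x 1 N (- x / s ^+ 2 * N x).
Proof.
have -> : N = fun x => normal_peak s * expR (- x ^+ 2 / (2 * s ^+ 2)).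
  by apply/funext => y; rewrite normal_pdf0E.
apply: is_derive_eq.
rewrite /GRing.scale/=.
by field; rewrite gt_eqF.
Qed.

(** The cumulative distribution function of the normal law, whose limits at
    both ends are those of any distribution function. *)
Lemma normal_pdf0_antiderivative : exists Phi : R -> R, [/\ forall x : R, is_derive x 1 Phi (N x),
  Phi x @[x --> +oo] --> (1 : R) & Phi x @[x --> -oo] --> (0 : R)].
Proof.
pose X : measurableTypeR R -> R := idfun.
have mX : measurable_fun setT X by exact: measurable_id.
pose XM := isMeasurableFun.Build _ _ _ _ X mX.
pose Y : {RV (normal_prob 0 s : probability _ R) >-> R} := HB.pack X XM.
exists (fun x => fine (cdf Y x)).
split.
- move=> x.
  have -> : (fun x => fine (cdf Y x)) = (fun x => (\int[lebesgue_measure]_(t in [set` `]-oo, x]]) N t)%R).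
    by [].
  have [] := @continuous_FTC1 R N -oo%O x (x + 1) _ _ _ _.
  + by rewrite ltrDl.
  + apply: (integrableS _ _ (subsetT _)) => //.
    exact: integrable_normal_pdf.
  + exact: ltNyr.
  + by apply: continuous_normal_pdf; rewrite gt_eqF.
  + move=> h1 h2; apply: DeriveDef; first exact: h1.
    rewrite -derive1E; exact: h2.
- exact: fine_cvg (cvg_cdfy1 Y).
- exact: fine_cvg (cvg_cdfNy0 Y).
Qed.

Lemma normal_pdf0_ge0 x : 0 <= N x. Proof. exact: normal_pdf_ge0. Qed.

Lemma normal_pdf0N x : N (- x) = N x. Proof. by rewrite !normal_pdf0E sqrrN. Qed.

Lemma cvg_invy : (x : R)^-1 @[x --> +oo] --> (0 : R).
Proof.
by apply/gtr0_cvgV0; [near=> x; near: x; exact: nbhs_pinfty_gt|exact: cvg_id].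
Unshelve. all: end_near. Qed.

(** For t = x^2 / (2 s^2) the inequality exp t >= t^2 / 2 bounds the left-hand
    side by a multiple of 1/x. *)
Lemma cvg_cube_normal_pdf0 : x ^+ 3 * N x @[x --> +oo] --> (0 : R).
Proof.
pose C := normal_peak s * (8 * s ^+ 4).
apply: (@squeeze_cvgr _ _ _ _ (cst 0) (fun x : R => C * x^-1)).
- near=> x.
  have x0 : 0 < x by near: x; exact: nbhs_pinfty_gt.
  rewrite mulr_ge0 ?normal_pdf0_ge0 ?exprn_ge0 ?(ltW x0)//=.
  rewrite normal_pdf0E mulrCA /C -[leRHS]mulrA ler_wpM2l ?normal_peak_ge0//.
  rewrite mulNr expRN ler_pdivrMr ?expR_gt0//.
  set y := x ^+ 2 / _.
  have y0 : 0 <= y by rewrite divr_ge0 ?sqr_ge0// mulr_ge0// sqr_ge0.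
  have h : y ^+ 2 / 2 <= expR y.
    by apply: le_trans (expR_ge1Dxn 1 y0); rewrite /factorial /= lerDr.
  apply: (@le_trans _ _ (8 * s ^+ 4 / x * (y ^+ 2 / 2))).
    rewrite le_eqVlt; apply/orP; left; apply/eqP; rewrite /y.
    by field; rewrite !gt_eqF.
  by rewrite ler_wpM2l// divr_ge0 ?mulr_ge0 ?exprn_ge0 ?ltW.
- exact: cvg_cst.
- rewrite -[X in _ --> X](mulr0 C); apply: cvgM; [exact: cvg_cst|exact: cvg_invy].
Unshelve. all: end_near. Qed.

Lemma cvg_id_normal_pdf0 : x * N x @[x --> +oo] --> (0 : R).
Proof.
have : x ^-1 * x^-1 * (x ^+ 3 * N x) @[x --> +oo] --> (0 * 0 * 0 : R).
  by apply: cvgM; [apply: cvgM; exact: cvg_invy|exact: cvg_cube_normal_pdf0].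
rewrite !mulr0; apply: cvg_trans; apply: near_eq_cvg; near=> x.
have x0 : x != 0 by rewrite gt_eqF//; near: x; exact: nbhs_pinfty_gt.
by field.
Unshelve. all: end_near. Qed.

(** Since N' = - x N / s^2, integration by parts lowers the degree: up to a
    multiple of the distribution function, a primitive is an odd polynomial
    times N, which vanishes at both ends.  The limit at +oo contains the moments
    s^2 and 3 s^4 of the normal law. *)
Lemma normal_moment_antiderivative (a0 a2 a4 : R) : exists P : R -> R,
  [/\ forall x : R, is_derive x 1 P ((a0 + a2 * x ^+ 2 + a4 * x ^+ 4) * N x),
      P x @[x --> +oo] --> a0 + a2 * s ^+ 2 + a4 * (3 * s ^+ 4) &
      P x @[x --> -oo] --> (0 : R)].
Proof.
have [Phi [dPhi Py PNy]] := normal_pdf0_antiderivative.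
pose K := a0 + a2 * s ^+ 2 + a4 * (3 * s ^+ 4).
pose b := a2 * s ^+ 2 + a4 * (3 * s ^+ 4).
pose c := a4 * s ^+ 2.
exists (fun x => K * Phi x - b * (x * N x) - c * (x ^+ 3 * N x)).
split.
- move=> x; have := is_derive_normal_pdf0 x => dN.
  apply: is_derive_eq.
  rewrite /GRing.scale/= /K /b /c.
  by field; rewrite gt_eqF.
- have -> : a0 + a2 * s ^+ 2 + a4 * (3 * s ^+ 4) = K * 1 - b * 0 - c * 0.
    by rewrite !mulr0 !subr0 mulr1.
  apply: cvgB; [apply: cvgB|]; apply: cvgM; do ?exact: cvg_cst => //.
  + exact: Py.
  + exact: cvg_id_normal_pdf0.
  + exact: cvg_cube_normal_pdf0.
- have -> : (0 : R) = K * 0 - b * - 0 - c * - 0 by rewrite oppr0 !mulr0 !subr0.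
  apply: cvgB; [apply: cvgB|]; apply: cvgM; do ?exact: cvg_cst => //.
  + exact: PNy.
  + rewrite cvgNy_compNP; under eq_fun do rewrite /= normal_pdf0N mulNr.
    by apply: cvgN; exact: cvg_id_normal_pdf0.
  + rewrite cvgNy_compNP; under eq_fun do rewrite /= normal_pdf0N exprNn -signr_odd expr1 mulN1r mulNr.
    by apply: cvgN; exact: cvg_cube_normal_pdf0.
Qed.

End gauss.

(** * Improper integrals over the positive half-line from a primitive *)

Section improper.
Variable R : realType.
Notation mu := (@lebesgue_measure R).

(** For a nonnegative function, monotone convergence along the half-lines
    from 1/(n+1) reduces the open half-line to closed ones, on which f is
    continuous up to the endpoint. *)
Lemma ge0_integral_FTC0y (f F : R -> R) (a b : R) :
  (forall x : R, 0 < x -> 0 <= f x) ->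
  {in `]0, +oo[, continuous f} ->
  (forall x : R, 0 < x -> is_derive x 1 F (f x)) ->
  F x @[x --> 0^'+] --> a -> F x @[x --> +oo] --> b ->
  (\int[mu]_(x in `]0%R, +oo[) (f x)%:E = (b - a)%:E)%E.
Proof.
move=> f0 cf dF Fa Fb.
have mf : measurable_fun (`]0, +oo[%classic : set (measurableTypeR R)) f.
  apply: open_continuous_measurable_fun => //.
  by move=> x; rewrite inE/=; exact: cf.
have cup : `]0%R, +oo[%classic = \bigcup_n `[n.+1%:R^-1, +oo[%classic :> set R.
  apply/seteqP; split => x /=.
    rewrite in_itv/= andbT => x0.
    exists (Num.truncn x^-1) => //=.
    rewrite in_itv/= andbT invf_ple ?posrE//.
    by rewrite ltW// truncnS_gt.
  by case=> n _ /=; rewrite !in_itv/= !andbT; apply: lt_le_trans.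
have := @ge0_nondecreasing_set_cvg_integral _ (measurableTypeR R) R (fun n => `[(n.+1%:R^-1 : R), +oo[%classic) (EFin \o f) mu.
rewrite -cup => H.
have int n : (\int[mu]_(x in `[((n.+1%:R : R)^-1)%R, +oo[) (f x)%:E)%E = (b - F (n.+1%:R^-1))%:E.
  rewrite (@ge0_continuous_FTC2y _ f F _ b)//.
  - by move=> x nx; apply: f0; apply: lt_le_trans nx.
  - apply: continuous_in_subspaceT => x; rewrite inE/= in_itv/= andbT => nx.
    by apply: cf; rewrite in_itv/= andbT; apply: lt_le_trans nx.
  - move=> x nx; have [] // := dF x _.
    by apply: lt_trans nx.
  - apply: cvg_at_right_filter; apply: differentiable_continuous.
    by apply/derivable1_diffP; have [] := dF n.+1%:R^-1 _.
  - move=> x; rewrite in_itv/= andbT => nx; rewrite derive1E; have [] // := dF x _.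
    by apply: lt_trans nx.
have C1 : (\int[mu]_(x in `[((n.+1%:R : R)^-1)%R, +oo[) (f x)%:E)%E @[n --> \oo]
    --> (\int[mu]_(x in `]0%R, +oo[) (f x)%:E)%E.
  apply: H.
  - move=> n m nm; apply/subsetPset; apply: subset_itvr.
    by rewrite bnd_simp lef_pV2 ?posrE// ler_nat.
  - by [].
  - move=> n; apply/measurable_EFinP.
    apply: (measurable_funS _ _ mf) => //.
    by apply: subset_itvr; rewrite bnd_simp.
  - move=> n x; rewrite /= in_itv/= andbT lee_fin => nx.
    by apply: f0; apply: lt_le_trans nx.
have C2 : (\int[mu]_(x in `[((n.+1%:R : R)^-1)%R, +oo[) (f x)%:E)%E @[n --> \oo]
    --> (b - a)%:E.
  under eq_fun do rewrite int.
  apply: cvg_EFin; first exact: nearW.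
  apply: cvgB; first exact: cvg_cst.
  by move/cvg_at_rightP: Fa; apply; split=> //; exact: cvg_harmonic.
exact: (cvg_unique _ C1 C2).
Qed.

(** The signed case follows from f = (f + g) - g, in which both terms are
    nonnegative and have primitives with finite limits. *)
Lemma Rintegral_FTC0y (f F g G : R -> R) (a b c d : R) :
  (forall x : R, 0 < x -> `|f x| <= g x) ->
  {in `]0, +oo[, continuous f} -> {in `]0, +oo[, continuous g} ->
  (forall x : R, 0 < x -> is_derive x 1 F (f x)) ->
  (forall x : R, 0 < x -> is_derive x 1 G (g x)) ->
  F x @[x --> 0^'+] --> a -> F x @[x --> +oo] --> b ->
  G x @[x --> 0^'+] --> c -> G x @[x --> +oo] --> d ->
  (\int[mu]_(x in `]0%R, +oo[) f x = b - a)%R.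
Proof.
move=> fg cf cg dF dG Fa Fb Gc Gd.
have g0 (x : R) : 0 < x -> 0 <= g x by move=> /fg; apply: le_trans.
have h0 (x : R) : 0 < x -> 0 <= (f \+ g) x.
  by move=> /fg; rewrite ler_norml => /andP[+ _]; rewrite /= -subr_ge0 opprK.
have ch : {in `]0, +oo[, continuous (f \+ g)}.
  by move=> x x0; apply: cvgD; [exact: cf|exact: cg].
have dH (x : R) : 0 < x -> is_derive x 1 (F \+ G) ((f \+ g) x).
  by move=> x0; have ? := dF x x0; have ? := dG x x0; apply: is_deriveD.
have Ha : (F \+ G) x @[x --> 0^'+] --> a + c by apply: cvgD.
have Hb : (F \+ G) x @[x --> +oo] --> b + d by apply: cvgD.
have ig := ge0_integral_FTC0y g0 cg dG Gc Gd.
have ih := ge0_integral_FTC0y h0 ch dH Ha Hb.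
have int (k : R -> R) (r : R) : (forall x : R, 0 < x -> 0 <= k x) -> {in `]0, +oo[, continuous k} ->
  (\int[mu]_(x in `]0%R, +oo[) (k x)%:E = r%:E)%E -> mu.-integrable `]0, +oo[ (EFin \o k).
  move=> k0 ck ik; apply/integrableP; split.
    apply/measurable_EFinP; apply: open_continuous_measurable_fun => //.
    by move=> x; rewrite inE/=; exact: ck.
  rewrite (_ : (\int[mu]_(x in `]0%R, +oo[) _)%E = r%:E) ?ltry// -ik.
  apply: eq_integral => x; rewrite inE/= in_itv/= andbT => x0.
  by rewrite ger0_norm// k0.
transitivity (\int[mu]_(x in `]0%R, +oo[) ((f \+ g) x - g x))%R.
  by apply: eq_Rintegral => x _ /=; rewrite addrK.
rewrite RintegralB//; [|exact: int ih|exact: int ig].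
rewrite /Rintegral ig ih/=.
by ring.
Qed.
End improper.

(** * Integrals against the inverse Gaussian density *)

Section ig_integral.
Variable R : realType.
Notation mu := (@lebesgue_measure R).
Variables (m s : R).
Hypotheses (m_gt0 : 0 < m) (s_gt0 : 0 < s).
Let N := normal_pdf 0 s.

(** The substitution that turns the exponent of the density into a square:
    (z - m)^2 / (m z) is the square of igu z. *)
Definition igw (z : R) := Num.sqrt (z / m).
Definition igu (z : R) := igw z - (igw z)^-1.
Definition igv (z : R) := igw z + (igw z)^-1.

Lemma igw_gt0 z : 0 < z -> 0 < igw z.
Proof. by move=> z0; rewrite sqrtr_gt0 divr_gt0. Qed.

Lemma igw_sqr z : 0 < z -> igw z ^+ 2 = z / m.
Proof. by move=> z0; rewrite sqr_sqrtr// divr_ge0// ltW. Qed.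

Lemma is_derive_igw (z : R) : 0 < z -> is_derive z 1 igw (igw z / (2 * z)).
Proof.
move=> z0; have zm : 0 < z / m by rewrite divr_gt0.
have h := is_derive1_sqrt zm.
have w0 := igw_gt0 z0; have w2 := igw_sqr z0.
have D : is_derive z 1 (fun z => z / m) (m^-1).
  by apply: is_derive_eq; rewrite /GRing.scale/=; ring.
apply: (is_derive_eq (@is_derive1_comp R Num.sqrt (fun z => z / m) z _ _ h D)).
rewrite -/(igw z).
move: (igw z) w0 w2 => w w0 w2.
have -> : z = m * w ^+ 2 by rewrite w2; field; rewrite gt_eqF.
by field; rewrite !gt_eqF.
Qed.

Lemma is_derive_igu (z : R) : 0 < z -> is_derive z 1 igu (igv z / (2 * z)).
Proof.
move=> z0; have w0 := igw_gt0 z0; have ? := is_derive_igw z0.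
have ? : igw z != 0 by rewrite gt_eqF.
apply: is_derive_eq.
rewrite /GRing.scale/= /igv; field.
by rewrite !gt_eqF.
Qed.

Lemma is_derive_igv (z : R) : 0 < z -> is_derive z 1 igv (igu z / (2 * z)).
Proof.
move=> z0; have w0 := igw_gt0 z0; have ? := is_derive_igw z0.
have ? : igw z != 0 by rewrite gt_eqF.
apply: is_derive_eq.
rewrite /GRing.scale/= /igu; field.
by rewrite !gt_eqF.
Qed.

Lemma igv_sqr z : 0 < z -> igv z ^+ 2 = igu z ^+ 2 + 4.
Proof. by move=> z0; rewrite /igv /igu; field; rewrite gt_eqF// igw_gt0. Qed.

(** The exponents of N at u and at v differ by a constant since v^2 = u^2 + 4. *)
Lemma normal_pdf0_igu z : 0 < z -> N (igu z) = expR (2 / s ^+ 2) * N (igv z).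
Proof.
move=> z0; rewrite /N !normal_pdf0E// [RHS]mulrCA; congr (_ * _).
rewrite -expRD igv_sqr//; congr expR.
by field; rewrite gt_eqF.
Qed.

Lemma igu_le z : 0 < z -> `|igu z| <= igv z.
Proof.
move=> z0; have w0 := igw_gt0 z0; have w1 : 0 < (igw z)^-1 by rewrite invr_gt0.
by rewrite ler_norml /igu /igv; apply/andP; split; lra.
Qed.

Lemma igw_cvgy : igw z @[z --> +oo] --> +oo.
Proof.
apply/cvgryPge => A; near=> z.
have z0 : 0 < z by near: z; exact: nbhs_pinfty_gt.
have [A0|A0] := lerP A 0; first by rewrite (le_trans A0)// ltW ?igw_gt0.
rewrite -(ler_pXn2r (ltn0Sn 1)) ?nnegrE ?(ltW A0) ?(ltW (igw_gt0 _))//.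
rewrite igw_sqr// ler_pdivlMr//; near: z; exact: nbhs_pinfty_ge.
Unshelve. all: end_near. Qed.

Lemma igwV_cvg0 : (igw z)^-1 @[z --> 0^'+] --> +oo.
Proof.
apply/cvgryPge => A; have [A0|A0] := lerP A 0; near=> z.
  have z0 : 0 < z by near: z; exact: nbhs_right_gt.
  by rewrite (le_trans A0)// invr_ge0 ltW ?igw_gt0.
have z0 : 0 < z by near: z; exact: nbhs_right_gt.
have h : igw z <= A^-1.
  rewrite -(ler_pXn2r (ltn0Sn 1)) ?nnegrE ?invr_ge0 ?(ltW A0) ?(ltW (igw_gt0 _))//.
  rewrite igw_sqr// ler_pdivrMr//; near: z; apply: nbhs_right_le.
  by apply: mulr_gt0 => //; apply: exprn_gt0; rewrite invr_gt0.
by rewrite -[A]invrK lef_pV2 ?posrE ?invr_gt0 ?igw_gt0.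
Unshelve. all: end_near. Qed.

Lemma igv_cvgy : igv z @[z --> +oo] --> +oo.
Proof.
apply: ger_cvgy igw_cvgy; near=> z.
have z0 : 0 < z by near: z; exact: nbhs_pinfty_gt.
by rewrite lerDl invr_ge0 ltW// igw_gt0.
Unshelve. all: end_near. Qed.

Lemma igv_cvg0 : igv z @[z --> 0^'+] --> +oo.
Proof.
apply: ger_cvgy igwV_cvg0; near=> z.
have z0 : 0 < z by near: z; exact: nbhs_right_gt.
by rewrite lerDr ltW// igw_gt0.
Unshelve. all: end_near. Qed.

Lemma igu_cvgy : igu z @[z --> +oo] --> +oo.
Proof.
apply/cvgryPge => A; near=> z.
have z0 : 0 < z by near: z; exact: nbhs_pinfty_gt.
have w1 : Num.max (A + 1) 1 <= igw z.
  by near: z; move/cvgryPge : igw_cvgy; exact.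
move: w1; rewrite ge_max /igu => /andP[w1 w2].
have : (igw z)^-1 <= 1 by rewrite invf_le1// igw_gt0.
lra.
Unshelve. all: end_near. Qed.

Lemma igu_cvg0 : igu z @[z --> 0^'+] --> -oo.
Proof.
apply/cvgrNyPle => A; near=> z.
have z0 : 0 < z by near: z; exact: nbhs_right_gt.
have w1 : Num.max (1 - A) 1 <= (igw z)^-1.
  by near: z; move/cvgryPge : igwV_cvg0; exact.
move: w1; rewrite ge_max /igu => /andP[w1 w2].
have : igw z <= 1 by rewrite -[igw z]invrK invf_le1// invr_gt0 igw_gt0.
lra.
Unshelve. all: end_near. Qed.

(** The first summand is an even polynomial in u against N(u) du, the second
    one against N(u) dv. *)
Definition ig_integrand (a0 a2 a4 b0 b2 b4 z : R) :=
  (a0 + a2 * igu z ^+ 2 + a4 * igu z ^+ 4) * N (igu z) * (igv z / (2 * z)) +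
  (b0 + b2 * igu z ^+ 2 + b4 * igu z ^+ 4) * N (igu z) * (igu z / (2 * z)).

Lemma continuous_ig_integrand a0 a2 a4 b0 b2 b4 :
  {in `]0, +oo[, continuous (ig_integrand a0 a2 a4 b0 b2 b4)}.
Proof.
move=> z; rewrite in_itv/= andbT => z0.
have ? := is_derive_igu z0; have ? := is_derive_igv z0.
have ? := is_derive1_comp (is_derive_normal_pdf0 s_gt0 (igu z)) (is_derive_igu z0).
have ? : 2 * z != 0 by rewrite gt_eqF// mulr_gt0.
apply: differentiable_continuous; apply/derivable1_diffP.
rewrite /ig_integrand.
pose Nu := normal_pdf 0 s \o igu.
rewrite (_ : (fun z => _) = fun z => (a0 + a2 * igu z ^+ 2 + a4 * igu z ^+ 4) * Nu z * (igv z / (2 * z)) +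
  (b0 + b2 * igu z ^+ 2 + b4 * igu z ^+ 4) * Nu z * (igu z / (2 * z)))//.
Qed.

(** A primitive is P(u) + e^c Q(v).  Only P contributes: u increases from -oo
    to +oo, while v tends to +oo at both ends.  In particular the b's, which
    belong to an odd function of u, integrate to 0. *)
Lemma Rintegral_ig_integrand (a0 a2 a4 b0 b2 b4 : R) :
  (\int[mu]_(z in `]0%R, +oo[) ig_integrand a0 a2 a4 b0 b2 b4 z)%R =
  a0 + a2 * s ^+ 2 + a4 * (3 * s ^+ 4).
Proof.
have primitive a0' a2' a4' b0' b2' b4' : exists F : R -> R,
  exists a, [/\ forall z : R, 0 < z -> is_derive z 1 F (ig_integrand a0' a2' a4' b0' b2' b4' z),
    F z @[z --> 0^'+] --> a & F z @[z --> +oo] --> a0' + a2' * s ^+ 2 + a4' * (3 * s ^+ 4) + a].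
  have [P [dP Py PNy]] := normal_moment_antiderivative s_gt0 a0' a2' a4'.
  (* The b-polynomial in u rewritten as a polynomial in v, using u^2 = v^2 - 4. *)
  have [Q [dQ Qy QNy]] := normal_moment_antiderivative s_gt0 (b0' - 4 * b2' + 16 * b4') (b2' - 8 * b4') b4'.
  set K := (X in Q x @[x --> +oo] --> X) in Qy.
  pose E := expR (2 / s ^+ 2).
  exists (fun z => P (igu z) + E * Q (igv z)), (E * K); split.
  - move=> z z0.
    have ? := is_derive1_comp (dP (igu z)) (is_derive_igu z0).
    have ? := is_derive1_comp (dQ (igv z)) (is_derive_igv z0).
    rewrite (_ : (fun z => _) = (P \o igu) + (fun z => E * (Q \o igv) z))//.
    apply: is_derive_eq; rewrite /GRing.scale/= /ig_integrand.
    have v4 : igv z ^+ 4 = (igu z ^+ 2 + 4) ^+ 2 by rewrite -igv_sqr// -exprM.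
    rewrite v4 igv_sqr// [X in _ = _ + _ * X * _]normal_pdf0_igu//.
    rewrite /N -/E.
    by field; rewrite gt_eqF.
  - rewrite -[X in _ --> X]add0r; apply: cvgD.
      by apply: cvg_comp PNy; exact: igu_cvg0.
    apply: cvgM; first exact: cvg_cst.
    by apply: cvg_comp Qy; exact: igv_cvg0.
  - apply: cvgD.
      by apply: cvg_comp Py; exact: igu_cvgy.
    apply: cvgM; first exact: cvg_cst.
    by apply: cvg_comp Qy; exact: igv_cvgy.
have [F [a [dF F0 Fy]]] := primitive a0 a2 a4 b0 b2 b4.
(* The dominating function: |u| <= v lets the du-weight bound both summands. *)
have [G [b [dG G0 Gy]]] := primitive (`|a0| + `|b0|) (`|a2| + `|b2|) (`|a4| + `|b4|) 0 0 0.
rewrite (Rintegral_FTC0y _ _ _ dF dG F0 Fy G0 Gy) ?addrK//; last 2 first.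
- exact: continuous_ig_integrand.
- exact: continuous_ig_integrand.
move=> z z0; rewrite /ig_integrand.
rewrite !(mul0r, addr0).
have vz : 0 <= igv z / (2 * z).
  by rewrite divr_ge0 ?(le_trans _ (igu_le z0))// mulr_ge0 ?ltW.
apply: le_trans (ler_normD _ _) _.
have e2 : 0 <= igu z ^+ 2 by exact: sqr_ge0.
have e4 : 0 <= igu z ^+ 4 by rewrite exprn_even_ge0.
have tri c0 c2 c4 : `|c0 + c2 * igu z ^+ 2 + c4 * igu z ^+ 4| <=
    `|c0| + `|c2| * igu z ^+ 2 + `|c4| * igu z ^+ 4.
  apply: le_trans (ler_normD _ _) _; apply: lerD.
    apply: le_trans (ler_normD _ _) _; apply: lerD => //.
    by rewrite normrM (ger0_norm e2).
  by rewrite normrM (ger0_norm e4).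
set U := igu z ^+ 2 in e2 tri *; set V := igu z ^+ 4 in e4 tri *.
rewrite [leRHS](_ : _ = (`|a0| + `|a2| * U + `|a4| * V) * N (igu z) * (igv z / (2 * z)) +
  (`|b0| + `|b2| * U + `|b4| * V) * N (igu z) * (igv z / (2 * z))); last by ring.
have N0 : 0 <= N (igu z) by exact: normal_pdf_ge0.
apply: lerD; rewrite !normrM (ger0_norm N0) normfV (gtr0_norm (mulr_gt0 _ z0))//.
  rewrite (@ger0_norm _ (igv z)) ?(le_trans _ (igu_le z0))//.
  by rewrite ler_wpM2r// ler_wpM2r.
apply: ler_pM.
- by rewrite mulr_ge0.
- by rewrite divr_ge0// mulr_ge0 ?ltW.
- by rewrite ler_wpM2r.
- by rewrite ler_wpM2r ?igu_le// invr_ge0 mulr_ge0 ?ltW.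
Qed.

End ig_integral.

(** * The Fisher metric of the inverse Gaussian family *)

Section metric.
Variable R : realType.

(** Directional derivatives reduce to derivatives in one real variable, to
    which the differentiation rules for compositions apply. *)
Lemma is_derive_line (V W : normedModType R) (f : V -> W) (a v : V) (d : W) :
  is_derive (0 : R) 1 (fun h : R => f (h *: v + a)) d -> is_derive a v f d.
Proof.
move=> [df <-]; have E : (fun h : R => h^-1 *: ((f \o shift a) (h *: v) - f a)) =
   (fun h : R => h^-1 *: (((fun h : R => f (h *: v + a)) \o shift 0) (h *: 1) - f (0 *: v + a))).
  by apply/funext => h /=; rewrite scale0r add0r addr0 /GRing.scale/= mulr1.
by split; rewrite /derivable/derive E.
Qed.

Lemma is_derive_ln_ig_pdf (t v : 'rV[R]_2) (z : R) : ig_param R t -> 0 < z ->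
  is_derive t v (fun t => ln (ig_pdf t z))
    (ig_mu v * (ig_lambda t * (z - ig_mu t) / ig_mu t ^+ 3) +
     ig_lambda v * ((2 * ig_lambda t)^-1 - (z - ig_mu t) ^+ 2 / (2 * ig_mu t ^+ 2 * z))).
Proof.
move=> [m0 l0] z0; apply: is_derive_line.
set m := ig_mu t in m0 *; set l := ig_lambda t in l0 *.
set p := ig_mu v; set q := ig_lambda v.
pose M (h : R) := h * p + m; pose L (h : R) := h * q + l.
pose g (h : R) := 2^-1 * ln (L h) - 2^-1 * ln (2 * pi * z ^+ 3)
  - L h * (z - M h) ^+ 2 * (2 * z)^-1 * (M h ^+ 2)^-1.
have M0 : M 0 = m by rewrite /M mul0r add0r.
have L0 : L 0 = l by rewrite /L mul0r add0r.
have z3 : 0 < 2 * pi * z ^+ 3 by rewrite !mulr_gt0// ?pi_gt0// exprn_gt0.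
have dM : is_derive (0 : R) 1 M p.
  by apply: is_derive_eq; rewrite /GRing.scale/=; ring.
have dL : is_derive (0 : R) 1 L q.
  by apply: is_derive_eq; rewrite /GRing.scale/=; ring.
have posnear (k : R -> R) (d : R) : is_derive (0 : R) 1 k d -> 0 < k 0 -> \forall h \near (0 : R), 0 < k h.
  move=> dk k0; have ck : {for (0 : R), continuous k}.
    by apply: differentiable_continuous; apply/derivable1_diffP; apply: ex_derive.
  exact: (cvgr_gt _ ck).
apply: (@near_eq_is_derive _ _ _ g).
  have Mn := posnear _ _ dM; rewrite M0 in Mn; have {}Mn := Mn m0.
  have Ln := posnear _ _ dL; rewrite L0 in Ln; have {}Ln := Ln l0.
  near=> h.
  have Mh : 0 < M h by near: h.
  have Lh : 0 < L h by near: h.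
  have em : ig_mu (h *: v + t) = M h by rewrite /ig_mu !mxE.
  have el : ig_lambda (h *: v + t) = L h by rewrite /ig_lambda !mxE.
  rewrite /ig_pdf em el lnM ?posrE ?expR_gt0 ?sqrtr_gt0 ?divr_gt0//.
  rewrite expRK -powR12_sqrt ?divr_ge0 ?ltW// ln_powR ln_div ?posrE//.
  by rewrite /g; field; rewrite !gt_eqF.
have ? : M 0 ^+ 2 != 0 by rewrite M0 gt_eqF// exprn_gt0.
have L0' : 0 < L 0 by rewrite L0.
have dl := is_derive1_comp (is_derive1_ln L0') dL.
rewrite (_ : g = fun h => 2^-1 * ((@ln R) \o L) h - 2^-1 * ln (2 * pi * z ^+ 3)
  - L h * (z - M h) ^+ 2 * (2 * z)^-1 * (M h ^+ 2)^-1)//.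
apply: is_derive_eq.
rewrite /GRing.scale/= M0 L0.
by field; rewrite !gt_eqF.
Unshelve. all: end_near. Qed.

Notation mu := (@lebesgue_measure R).

(** Here 2/w = v - u, so the density is N(u) (u' - v'). *)
Lemma ig_pdfE (t : 'rV[R]_2) (z : R) : ig_param R t -> 0 < z ->
  let s := Num.sqrt (ig_mu t / ig_lambda t) in
  ig_pdf t z = normal_pdf 0 s (igu (ig_mu t) z) / (igw (ig_mu t) z * z).
Proof.
move=> [m0 l0] z0 s; rewrite /ig_pdf.
have s2 : s ^+ 2 = ig_mu t / ig_lambda t by rewrite sqr_sqrtr// divr_ge0 ?ltW.
have s0 : 0 < s by rewrite sqrtr_gt0 divr_gt0.
have w0 := igw_gt0 m0 z0; have w2 := igw_sqr m0 z0.
rewrite normal_pdf0E// [RHS]mulrAC; congr (_ * _); last first.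
  congr expR.
  rewrite s2 /igu.
  have -> : (igw (ig_mu t) z - (igw (ig_mu t) z)^-1) ^+ 2 =
     igw (ig_mu t) z ^+ 2 - 2 + (igw (ig_mu t) z ^+ 2)^-1 by field; rewrite gt_eqF.
  by rewrite w2; field; rewrite !gt_eqF.
rewrite /normal_peak.
have z3 : 0 < 2 * pi * z ^+ 3 by rewrite !mulr_gt0// ?pi_gt0// exprn_gt0.
have sp : 0 < s ^+ 2 * pi *+ 2.
  by rewrite mulrn_wgt0// mulr_gt0 ?pi_gt0// exprn_gt0.
apply/eqP; rewrite -(@eqrXn2 _ 2)// ?sqrtr_ge0//; last first.
  by rewrite divr_ge0 ?invr_ge0 ?sqrtr_ge0// mulr_ge0 ?ltW.
rewrite sqr_sqrtr; last by rewrite divr_ge0 ?ltW.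
rewrite exprMn !exprVn exprMn w2 sqr_sqrtr ?ltW// s2; apply/eqP.
have p0 := pi_gt0 R; move: (@pi R) p0 {z3 sp} => p p0.
by field; rewrite !gt_eqF.
Qed.

(** The score in a direction is a combination of (z - m), which is m w u, and
    of an even polynomial in u; the weight 1/w in the density is absorbed by
    w = (u + v) / 2 and 1/w = (v - u) / 2. *)
Lemma ig_metricE (t : 'rV[R]_2) : ig_param R t ->
  forall j k, ig_metric t j k =
    if j != k then 0 else if j == 0 then ig_lambda t / ig_mu t ^+ 3
                                     else (2 * ig_lambda t ^+ 2)^-1.
Proof.
move=> tP; have [m0 l0] := tP.
set m := ig_mu t in m0 *; set l := ig_lambda t in l0 *.
pose s := Num.sqrt (m / l).
have s2 : s ^+ 2 = m / l by rewrite sqr_sqrtr// divr_ge0 ?ltW.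
have s0 : 0 < s by rewrite sqrtr_gt0 divr_gt0.
have key (c0 c1 d0 d1 : R) : (\int[mu]_(z in `]0%R, +oo[)
  ((c0 * (l * (z - m) / m ^+ 3) + c1 * ((2 * l)^-1 - (z - m) ^+ 2 / (2 * m ^+ 2 * z))) *
   (d0 * (l * (z - m) / m ^+ 3) + d1 * ((2 * l)^-1 - (z - m) ^+ 2 / (2 * m ^+ 2 * z))) *
   ig_pdf t z))%R = c0 * d0 * (l / m ^+ 3) + c1 * d1 * (2 * l ^+ 2)^-1.
  (* In the product of the two scores, A2 and C are the coefficients of the
     part even in u and B is the coefficient of the odd part. *)
  pose A2 := c0 * d0 * l ^+ 2 / m ^+ 4.
  pose B := c0 * d1 + c1 * d0.
  pose C := c1 * d1.
  transitivity (\int[mu]_(z in `]0%R, +oo[)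
    ig_integrand m s (C / (4 * l ^+ 2)) (A2 - C / (2 * l * m)) (C / (4 * m ^+ 2))
      (- (C / (4 * l ^+ 2)) + B / m ^+ 2)
      (A2 + C / (2 * l * m) - B * l / m ^+ 3) (- (C / (4 * m ^+ 2))) z)%R.
    apply: eq_Rintegral => z; rewrite inE/= in_itv/= andbT => z0.
    rewrite ig_pdfE// -/m -/l -/s /ig_integrand.
    have w0 := igw_gt0 m0 z0; have w2 := igw_sqr m0 z0.
    rewrite /igv /igu; move: (normal_pdf _ _ _) => N.
    move: (igw m z) w0 w2 => w w0 w2.
    have -> : z = m * w ^+ 2 by rewrite w2; field; rewrite gt_eqF.
    by rewrite /A2 /B /C; field; rewrite !gt_eqF.
  have s4 : s ^+ 4 = (m / l) ^+ 2 by rewrite -s2 -exprM.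
  rewrite Rintegral_ig_integrand// s4 s2 /A2 /C.
  by field; rewrite !gt_eqF.
move=> j k; rewrite mxE.
pose c (i : 'I_2) := (ig_mu (delta_mx 0 i : 'rV[R]_2), ig_lambda (delta_mx 0 i : 'rV[R]_2)).
transitivity ((c j).1 * (c k).1 * (l / m ^+ 3) + (c j).2 * (c k).2 * (2 * l ^+ 2)^-1).
  rewrite -key; apply: eq_Rintegral => z; rewrite inE/= in_itv/= andbT => z0.
  have [_ ->] := is_derive_ln_ig_pdf (delta_mx 0 j) tP z0.
  by have [_ ->] := is_derive_ln_ig_pdf (delta_mx 0 k) tP z0.
rewrite /c/= /ig_mu /ig_lambda !mxE.
case: j => [[|[|//]]] ?; case: k => [[|[|//]]] ? //=;
by rewrite !(mulr0, mul0r, mul1r, addr0, add0r).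
Qed.

End metric.

(** * Smoothness of Laurent polynomial maps *)

Section smooth.
Variable R : realType.

(** Differentials only see germs; this is needed because the maps of the
    parameter space are extended by 0 outside it. *)
Lemma near_eq_differentiable (V W : normedModType R) (f g : V -> W) (x : V) :
  (\forall y \near x, f y = g y) -> differentiable f x -> differentiable g x.
Proof.
move=> fg df; have [dfc dfE] := (diff_locallyP _ _).1 df.
have E : g \o shift x = cst (g x) + 'd f x +o_ 0 id.
  apply/eqaddoP => e e0; move/eqaddoP : dfE => /(_ e e0).
  have fg0 : \forall h \near (0 : V), f (h + x) = g (h + x).
    by move: fg; rewrite (near_shift 0); apply: filterS => h /=; rewrite subr0.
  move=> H; near=> h.
  have : f (h + x) = g (h + x) by near: h.
  have := nbhs_singleton fg; rewrite /= => Ex Eh.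
  have : `|(f \o shift x - (cst (f x) + 'd f x)) h| <= e * `|id h| by near: h.
  by rewrite !fctE /= Ex Eh.
by apply/diff_locallyP; rewrite (diff_unique dfc E).
Unshelve. all: end_near. Qed.

Lemma nbhs_ig_param (t : 'rV[R]_2) : ig_param R t -> \forall u \near t, ig_param R u.
Proof.
move=> [m0 l0]; near=> u; split; near: u.
- by apply: (cvgr_gt (ig_mu t)) => //; exact: coord_continuous.
- by apply: (cvgr_gt (ig_lambda t)) => //; exact: coord_continuous.
Unshelve. all: end_near. Qed.

(** The algebra of Laurent polynomials in mu and lambda: it is closed under
    directional derivatives, which gives smoothness of all orders at once. *)
Inductive laurent : ('rV[R]_2 -> R) -> Prop :=
| laurent_cst c : laurent (fun=> c)
| laurent_mu : laurent (@ig_mu R)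
| laurent_lambda : laurent (@ig_lambda R)
| laurent_muV : laurent (fun t => (ig_mu t)^-1)
| laurent_lambdaV : laurent (fun t => (ig_lambda t)^-1)
| laurent_add f g : laurent f -> laurent g -> laurent (fun t => f t + g t)
| laurent_mul f g : laurent f -> laurent g -> laurent (fun t => f t * g t).

Lemma is_derive_coord (i : 'I_2) (t v : 'rV[R]_2) :
  is_derive t v (fun t => t 0 i) (v 0 i).
Proof.
apply: is_derive_line.
rewrite (_ : (fun h => _) = (fun h => h * v 0 i + t 0 i)).
  by apply: is_derive_eq; rewrite /GRing.scale/=; ring.
by apply/funext => h; rewrite !mxE.
Qed.

Lemma laurent_differentiable f t : laurent f -> ig_param R t -> differentiable f t.
Proof.
move=> lf tP; have [m0 l0] := tP; elim: lf => [c|||||g h _ dg _ dh|g h _ dg _ dh].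
- exact: differentiable_cst.
- exact: differentiable_coord.
- exact: differentiable_coord.
- apply: differentiableV; first exact: differentiable_coord.
  by rewrite gt_eqF.
- apply: differentiableV; first exact: differentiable_coord.
  by rewrite gt_eqF.
- exact: differentiableD.
- exact: differentiableM.
Qed.

Lemma laurent_derive f v : laurent f ->
  exists2 g, laurent g & forall t, ig_param R t -> 'D_v f t = g t.
Proof.
elim=> [c|||||g h lg [g' lg' dg] lh [h' lh' dh]|g h lg [g' lg' dg] lh [h' lh' dh]].
- by exists (fun=> 0); [exact: laurent_cst|move=> t _; rewrite derive_cst].
- exists (fun=> v 0 0); [exact: laurent_cst|move=> t _].
  by have [_ ->] := is_derive_coord 0 t v.
- exists (fun=> v 0 1); [exact: laurent_cst|move=> t _].
  by have [_ ->] := is_derive_coord 1 t v.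
- exists (fun t => (- v 0 0) * ((ig_mu t)^-1 * (ig_mu t)^-1)).
    by apply: laurent_mul; [exact: laurent_cst|apply: laurent_mul; exact: laurent_muV].
  move=> t [m0 l0]; rewrite deriveV ?gt_eqF//; last first.
    by have [] := is_derive_coord 0 t v.
  have [_ ->] := is_derive_coord 0 t v.
  by rewrite /GRing.scale/= /ig_mu; field; rewrite gt_eqF.
- exists (fun t => (- v 0 1) * ((ig_lambda t)^-1 * (ig_lambda t)^-1)).
    by apply: laurent_mul; [exact: laurent_cst|apply: laurent_mul; exact: laurent_lambdaV].
  move=> t [m0 l0]; rewrite deriveV ?gt_eqF//; last first.
    by have [] := is_derive_coord 1 t v.
  have [_ ->] := is_derive_coord 1 t v.
  by rewrite /GRing.scale/= /ig_lambda; field; rewrite gt_eqF.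
- exists (fun t => g' t + h' t); first exact: laurent_add.
  move=> t tP; rewrite deriveD ?dg ?dh//; apply: diff_derivable; exact: laurent_differentiable.
- exists (fun t => g t * h' t + h t * g' t).
    by apply: laurent_add; apply: laurent_mul.
  move=> t tP; rewrite deriveM ?dg ?dh//; apply: diff_derivable; exact: laurent_differentiable.
Qed.

Definition row2 (a b : R) : 'rV[R]_2 := \row_i [:: a; b]`_i.

Lemma row2_eta (x : 'rV[R]_2) : x = row2 (x 0 0) (x 0 1).
Proof.
by apply/rowP => i; rewrite mxE; case: i => [[|[|//]]] ?; congr (x _ _); exact/val_inj.
Qed.

Lemma differentiable_row2 (f g : 'rV[R]_2 -> R) t :
  differentiable f t -> differentiable g t ->
  differentiable (fun t => row2 (f t) (g t)) t.
Proof.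
move=> df dg; rewrite (_ : (fun t => _) =
  (fun t => f t *: row2 1 0) + (fun t => g t *: row2 0 1)).
  by apply: differentiableD; apply: differentiableZl.
apply/funext => u; apply/rowP => i; rewrite !mxE.
by case: i => [[|[|//]]] ? /=; ring.
Qed.

Lemma derive_row2 (f g : 'rV[R]_2 -> R) t v :
  differentiable f t -> differentiable g t ->
  'D_v (fun t => row2 (f t) (g t)) t = row2 ('D_v f t) ('D_v g t).
Proof.
move=> df dg; rewrite derive_mx; last exact/diff_derivable/differentiable_row2.
apply/rowP => i; rewrite !mxE; case: i => [[|[|//]]] ? /=;
by congr ('D_v _ t); apply/funext => u; rewrite mxE.
Qed.

(** The induction invariant for smoothness: agreement on an open set survives
    differentiation. *)
Definition row_laurent (F : 'rV[R]_2 -> 'rV[R]_2) := exists f g,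
  [/\ laurent f, laurent g & forall t, ig_param R t -> F t = row2 (f t) (g t)].

Lemma row_laurent_smooth F : row_laurent F -> smooth_on (ig_param R) F.
Proof.
move=> lF s; have diffl G t : row_laurent G -> ig_param R t -> differentiable G t.
  move=> [f [g [lf lg E]]] tP.
  apply: (@near_eq_differentiable _ _ (fun t => row2 (f t) (g t))).
    by apply: filterS (nbhs_ig_param tP) => u uP; rewrite E.
  by apply: differentiable_row2; exact: laurent_differentiable.
move=> x xP; apply: diffl xP; elim: s => //= v s [f [g [lf lg E]]].
have [f' lf' df] := laurent_derive v lf; have [g' lg' dg] := laurent_derive v lg.
exists f', g'; split=> // t tP.
rewrite -df// -dg// -derive_row2; try exact: laurent_differentiable.
apply: near_eq_derive.
by apply: filterS (nbhs_ig_param tP) => u uP; rewrite E.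
Qed.

End smooth.

(** * Rescalings of the parameter *)

Section jac.
Variable R : realType.
Implicit Types (t v : 'rV[R]_2) (a : R) (e : bool).

Lemma valLR_val n (M : set 'rV[R]_n) (f : M -> M) (x : M) :
  valLR 0 f (val x) = val (f x).
Proof.
by rewrite /valLR/= oinv_set_val; case: insubP => [u _ /val_inj <-//|]; rewrite (valP x).
Qed.

Lemma jacobian_entry (F : 'rV[R]_2 -> 'rV[R]_2) t i j : differentiable F t ->
  'J F t i j = 'D_(delta_mx 0 i) (fun t => F t 0 j) t.
Proof.
move=> dF; have := deriveEjacobian (delta_mx 0 i) dF.
rewrite derive_mx; last exact: diff_derivable.
by move=> /(congr1 (fun M : 'rV_2 => M 0 j)); rewrite mxE -rowE mxE => <-.
Qed.

(** This is the squared Euclidean norm of the coordinates (mu^(-1/2),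
    (2 lambda)^(-1/2)). *)
Definition ig_radius2 t : R := (ig_mu t)^-1 + (2 * ig_lambda t)^-1.

(** The factor is constant for a dilation; an inversion of radius r in the
    half-plane coordinates multiplies mu and lambda by radius2^2 / r^4.  The
    exponential makes the positive constant range over the additive group. *)
Definition ig_factor a e t : R := expR a * (if e then ig_radius2 t ^+ 2 else 1).

Lemma ig_radius2_gt0 t : ig_param R t -> 0 < ig_radius2 t.
Proof. by move=> [m0 l0]; rewrite addr_gt0 ?invr_gt0 ?mulr_gt0. Qed.

Lemma ig_factor_gt0 a e t : ig_param R t -> 0 < ig_factor a e t.
Proof.
move=> /ig_radius2_gt0 s0; rewrite mulr_gt0 ?expR_gt0//.
by case: e => //; rewrite exprn_gt0.
Qed.

Lemma ig_muZ a t : ig_mu (a *: t) = a * ig_mu t. Proof. by rewrite /ig_mu mxE. Qed.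
Lemma ig_lambdaZ a t : ig_lambda (a *: t) = a * ig_lambda t.
Proof. by rewrite /ig_lambda mxE. Qed.

Lemma ig_radius2Z a t : ig_radius2 (a *: t) = a^-1 * ig_radius2 t.
Proof. by rewrite /ig_radius2 ig_muZ ig_lambdaZ mulrCA !invfM mulrDr. Qed.

Lemma ig_paramZ a t : 0 < a -> ig_param R t -> ig_param R (a *: t).
Proof. by move=> a0 [m0 l0]; split; rewrite ?ig_muZ ?ig_lambdaZ mulr_gt0. Qed.

Lemma ig_paramP (t : ig_param R) : ig_param R (val t).
Proof. exact: set_mem (valP t). Qed.

Definition ig_rescale a e (t : ig_param R) : ig_param R :=
  SigSub (mem_set (ig_paramZ (ig_factor_gt0 a e (ig_paramP t)) (ig_paramP t))).

Lemma val_ig_rescale a e (t : ig_param R) : val (ig_rescale a e t) = ig_factor a e (val t) *: val t.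
Proof. by []. Qed.

(** The twisted addition of a dihedral group: a preceding rescaling by k
    divides radius2 by k, hence the factor of an inversion by k^2. *)
Lemma ig_rescale_comp a b e e' :
  ig_rescale a e \o ig_rescale b e' = ig_rescale (a + if e then - b else b) (e (+) e').
Proof.
apply/funext => t; apply: val_inj; rewrite /comp !val_ig_rescale scalerA.
congr (_ *: _); rewrite /ig_factor ig_radius2Z.
have s0 := ig_radius2_gt0 (ig_paramP t); rewrite /ig_factor.
have b0 := expR_gt0 b.
by case: e; case: e' => /=; rewrite expRD ?expRN; field; rewrite ?gt_eqF.
Qed.

Lemma ig_rescale0 : ig_rescale 0 false = id.
Proof.
by apply/funext => t; apply: val_inj; rewrite val_ig_rescale /ig_factor expR0 mulr1 scale1r.
Qed.

Lemma ig_rescale_smooth a e : row_laurent (valLR 0 (ig_rescale a e)).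
Proof.
have E t (tP : ig_param R t) : valLR 0 (ig_rescale a e) t = ig_factor a e t *: t.
  by rewrite -[t in LHS]/(val (SigSub (mem_set tP) : ig_param R)) valLR_val.
have ls : laurent (@ig_radius2).
  rewrite (_ : ig_radius2 = fun t => (ig_mu t)^-1 + 2^-1 * (ig_lambda t)^-1).
    apply: laurent_add; first exact: laurent_muV.
    by apply: laurent_mul; [exact: laurent_cst|exact: laurent_lambdaV].
  by apply/funext => t; rewrite /ig_radius2 invfM.
have lk : laurent (ig_factor a e).
  rewrite /ig_factor; apply: laurent_mul; first exact: laurent_cst.
  by case: e {E}; [apply: laurent_mul|exact: laurent_cst].
exists (fun t => ig_factor a e t * ig_mu t), (fun t => ig_factor a e t * ig_lambda t).
split.
- by apply: laurent_mul => //; exact: laurent_mu.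
- by apply: laurent_mul => //; exact: laurent_lambda.
- move=> t tP; rewrite E// [LHS]row2_eta; congr row2.
    by rewrite -ig_muZ.
  by rewrite -ig_lambdaZ.
Qed.

Lemma is_derive_radius2 t v : ig_param R t -> is_derive t v ig_radius2
  (- (v 0 0 / ig_mu t ^+ 2) - v 0 1 / (2 * ig_lambda t ^+ 2)).
Proof.
move=> [m0 l0]; apply: is_derive_line.
rewrite (_ : (fun h => _) = fun h => (h * v 0 0 + ig_mu t)^-1 + (2 * (h * v 0 1 + ig_lambda t))^-1).
  have ? : 0 * v 0 0 + ig_mu t != 0 by rewrite mul0r add0r gt_eqF.
  have ? : 2 * (0 * v 0 1 + ig_lambda t) != 0 by rewrite mul0r add0r gt_eqF// mulr_gt0.
  apply: is_derive_eq; rewrite /GRing.scale/= !mul0r !add0r.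
  by field; rewrite !gt_eqF.
by apply/funext => h; rewrite /ig_radius2 /ig_mu /ig_lambda !mxE.
Qed.

Lemma is_derive_factor a e t v : ig_param R t -> is_derive t v (ig_factor a e)
  (if e then expR a * (2 * ig_radius2 t * (- (v 0 0 / ig_mu t ^+ 2) - v 0 1 / (2 * ig_lambda t ^+ 2)))
   else 0).
Proof.
move=> tP; have ? := is_derive_radius2 v tP; rewrite /ig_factor.
by case: e; apply: is_derive_eq; rewrite /GRing.scale/=; ring.
Qed.

Lemma jacobian_ig_rescale a e (x : ig_param R) i j : let t := val x in
  'J (valLR 0 (ig_rescale a e)) t i j =
  (if e then expR a * (2 * ig_radius2 t * (- ((i == 0)%:R / ig_mu t ^+ 2) - (i == 1)%:R / (2 * ig_lambda t ^+ 2)))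
   else 0) * t 0 j + ig_factor a e t * (i == j)%:R.
Proof.
move=> t; have tP : ig_param R t := ig_paramP x.
rewrite jacobian_entry; last first.
  exact: (row_laurent_smooth (ig_rescale_smooth a e) [::] tP).
transitivity ('D_(delta_mx 0 i) (fun t => ig_factor a e t * t 0 j) t).
  apply: near_eq_derive; apply: filterS (nbhs_ig_param tP) => u uP.
  rewrite -[u in LHS]/(val (SigSub (mem_set uP) : ig_param R)) valLR_val.
  by rewrite val_ig_rescale mxE.
have d1 := is_derive_factor a e (delta_mx 0 i) tP.
have d2 := is_derive_coord j t (delta_mx 0 i).
have [_ ->] := is_deriveM d1 d2.
rewrite /GRing.scale/= !mxE !eqxx/= [j == i]eq_sym [0 == i]eq_sym [1 == i]eq_sym.
by rewrite addrC [t 0 j * _]mulrC.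
Qed.

Lemma sum_ord2 (f : 'I_2 -> R) : \sum_k f k = f 0 + f 1.
Proof. by rewrite !big_ord_recl big_ord0 addr0; congr (_ + f _); exact/val_inj. Qed.

Lemma mulmx_tr2 (A G : 'M[R]_2) i j : (A *m G *m A^T) i j =
  (A i 0 * G 0 0 + A i 1 * G 1 0) * A j 0 + (A i 0 * G 0 1 + A i 1 * G 1 1) * A j 1.
Proof. by rewrite mxE sum_ord2 !mxE !sum_ord2. Qed.

(** The inverse is again a rescaling, so smoothness of both is that of Laurent
    polynomials; the metric condition is a rational identity in mu, lambda. *)
Lemma ig_rescale_isometry a e : ig_isometries R (ig_rescale a e).
Proof.
pose a' := if e then a else - a.
exists (ig_rescale a' e); split.
- move=> t; rewrite -[LHS]/((ig_rescale _ _ \o ig_rescale _ _) t) ig_rescale_comp /a' addbb.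
  by rewrite -[RHS]/(id t) -ig_rescale0; congr (ig_rescale _ _ t); case: (e); ring.
- move=> t; rewrite -[LHS]/((ig_rescale _ _ \o ig_rescale _ _) t) ig_rescale_comp /a' addbb.
  by rewrite -[RHS]/(id t) -ig_rescale0; congr (ig_rescale _ _ t); case: (e); ring.
- exact/row_laurent_smooth/ig_rescale_smooth.
- exact/row_laurent_smooth/ig_rescale_smooth.
- move=> x; apply/matrixP => i j; rewrite mulmx_tr2 !jacobian_ig_rescale.
  have tP := ig_paramP x; have tP' := ig_paramP (ig_rescale a e x).
  rewrite !ig_metricE// ?val_ig_rescale ?ig_muZ ?ig_lambdaZ -/(ig_mu _) -/(ig_lambda _).
  have s0 := ig_radius2_gt0 tP; have [m0 l0] := tP; have a0 := expR_gt0 a.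
  rewrite /ig_factor /ig_radius2.
  move: (ig_mu _) (ig_lambda _) (expR a) m0 l0 a0 {s0 tP tP'} => m l E m0 l0 E0.
  have ml : 0 < 2 * l + m by rewrite addr_gt0// mulr_gt0.
  by case: i => [[|[|//]]] ?; case: j => [[|[|//]]] ? /=; case: (e) => /=; field;
    rewrite !gt_eqF.
Qed.

End jac.

(** * Hyperbolic length bounds hyperbolic distance *)

Section curve.
Variable R : realType.

(** The hyperbolic cosine of the hyperbolic distance in the upper half-plane;
    unlike the distance itself it is a rational function. *)
Definition cosh_dist (x1 y1 x2 y2 : R) :=
  ((x1 - x2) ^+ 2 + y1 ^+ 2 + y2 ^+ 2) / (2 * y1 * y2).

Lemma cosh_dist_ge1 x1 y1 x2 y2 : 0 < y1 -> 0 < y2 -> 1 <= cosh_dist x1 y1 x2 y2.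
Proof.
move=> y10 y20; rewrite ler_pdivlMr ?mulr_gt0// mul1r.
have := sqr_ge0 (x1 - x2); have := sqr_ge0 (y1 - y2); nra.
Qed.

(** E is the exponential of the distance of which G is the hyperbolic cosine. *)
Lemma cosh_exp_surj (G : R) : 1 <= G -> exists2 E, 1 <= E & G = (E + E^-1) / 2.
Proof.
move=> G1; have d0 : 0 <= G ^+ 2 - 1 by rewrite subr_ge0 exprn_ege1.
pose r := Num.sqrt (G ^+ 2 - 1).
have r0 : 0 <= r by exact: sqrtr_ge0.
have r2 : r ^+ 2 = G ^+ 2 - 1 by rewrite sqr_sqrtr.
have E0 : G + r != 0 by rewrite gt_eqF//; lra.
exists (G + r); first lra.
have -> : (G + r)^-1 = G - r.
  apply: (mulfI E0); rewrite mulfV//.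
  have -> : (G + r) * (G - r) = G ^+ 2 - r ^+ 2 by ring.
  by rewrite r2; ring.
by field.
Qed.

Lemma le_cosh_exp (E F : R) : 1 <= E -> E <= F -> (E + E^-1) / 2 <= (F + F^-1) / 2.
Proof.
move=> E1 EF; have E0 : 0 < E by lra. have F0 : 0 < F by lra.
rewrite -subr_ge0.
have -> : (F + F^-1) / 2 - (E + E^-1) / 2 = (F - E) * (E * F - 1) / (2 * E * F).
  by field; rewrite !gt_eqF.
rewrite divr_ge0 ?mulr_ge0 ?subr_ge0 ?(ltW E0) ?(ltW F0)//.
by nra.
Qed.

(** With the parameter t read as exp(arc length), the hypothesis says that the
    speed is at most 1, so the length is at most log E0.  Let F be the
    horocyclic function of the ideal point beyond the endpoint on the geodesic
    from the start to the end.  Then |grad log F| = 1 for the hyperbolic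
    metric, so t F does not decrease along the curve, while between the two endpoints F
    decreases by exactly the factor E. *)
Lemma cosh_dist_curve (x y dx dy : R -> R) (E0 : R) : 1 <= E0 ->
  (forall t, t \in `[1, E0] -> is_derive t 1 x (dx t)) ->
  (forall t, t \in `[1, E0] -> is_derive t 1 y (dy t)) ->
  (forall t, t \in `[1, E0] -> 0 < y t) ->
  (forall t, t \in `[1, E0] -> (dx t ^+ 2 + dy t ^+ 2) * t ^+ 2 <= y t ^+ 2) ->
  cosh_dist (x 1) (y 1) (x E0) (y E0) <= (E0 + E0^-1) / 2.
Proof.
move=> E01 dX dY y0 speed.
have in1 : 1 \in `[1, E0] by rewrite in_itv/= lexx.
have inE0 : E0 \in `[1, E0] by rewrite in_itv/= E01 lexx.
have [x1 ex1] : exists u, u = x 1 by exists (x 1).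
have [y1 ey1] : exists u, u = y 1 by exists (y 1).
have [x2 ex2] : exists u, u = x E0 by exists (x E0).
have [y2 ey2] : exists u, u = y E0 by exists (y E0).
have y10 : 0 < y1 by rewrite ey1; exact: y0.
have y20 : 0 < y2 by rewrite ey2; exact: y0.
rewrite -ex1 -ey1 -ex2 -ey2.
have := cosh_dist_ge1 x1 x2 y10 y20.
have [G GE] : exists u, u = cosh_dist x1 y1 x2 y2 by exists (cosh_dist x1 y1 x2 y2).
rewrite -GE => G1.
have [E E1 GEE] := cosh_exp_surj G1.
rewrite GEE; apply: le_cosh_exp => //.
move: E1; rewrite le_eqVlt => /predU1P[<-//|E1].
have Epos : 0 < E by lra.
(* F is the Lorentz pairing with the null vector q - p / E, for the endpoints
   p, q of the curve; b^2 = 4 a c says that this vector is null. *)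
pose c := (2 * y2)^-1 - (2 * E * y1)^-1.
pose b := x1 / (E * y1) - x2 / y2.
pose a := (x2 ^+ 2 + y2 ^+ 2) / (2 * y2) - (x1 ^+ 2 + y1 ^+ 2) / (2 * E * y1).
pose F u v := (a + b * u + c * (u ^+ 2 + v ^+ 2)) / v.
have disc : 4 * a * c = b ^+ 2.
  apply/eqP; rewrite -subr_eq0; apply/eqP.
  transitivity (1 + E^-1 ^+ 2 - 2 * G / E).
    by rewrite GE /a /b /c /cosh_dist; field; rewrite !gt_eqF.
  by rewrite GEE; field; rewrite gt_eqF.
have FP : F x1 y1 = (E - E^-1) / 2.
  transitivity (G - E^-1); last by rewrite GEE; field; rewrite gt_eqF.
  by rewrite GE /F /a /b /c /cosh_dist; field; rewrite !gt_eqF.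
have FQ : F x2 y2 = F x1 y1 / E.
  transitivity (1 - G / E).
    by rewrite GE /F /a /b /c /cosh_dist; field; rewrite !gt_eqF.
  by rewrite FP GEE; field; rewrite !gt_eqF.
have FP0 : 0 < F x1 y1.
  by rewrite FP divr_gt0// subr_gt0 (lt_trans _ E1)// invf_lt1.
(* A null functional vanishes nowhere, so it keeps the sign it has at p. *)
have Fpos u v : 0 < v -> 0 < F u v.
  have cF z w : 0 < w -> c * (w * F z w) = (c * z + b / 2) ^+ 2 + c ^+ 2 * w ^+ 2.
    move=> w0; transitivity (c * a + c * b * z + c ^+ 2 * (z ^+ 2 + w ^+ 2)).
      by rewrite /F; field; rewrite gt_eqF.
    have -> : c * a = b ^+ 2 / 4 by rewrite -disc; field.
    by field.
  move=> v0; have [c0|c0] := eqVneq c 0.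
    have b0 : b = 0 by apply/eqP; rewrite -sqrf_eq0 -disc c0 mulr0.
    move: FP0; rewrite /F c0 b0 !mul0r !addr0 !pmulr_lgt0 ?invr_gt0//.
  have cpos : 0 < c.
    have : 0 < c * (y1 * F x1 y1).
      by rewrite cF// ltr_wpDl ?sqr_ge0// mulr_gt0// exprn_even_gt0//= gt_eqF.
    by rewrite pmulr_lgt0// mulr_gt0.
  have : 0 < c * (v * F u v).
    by rewrite cF// ltr_wpDl ?sqr_ge0// mulr_gt0 ?exprn_gt0.
  by rewrite pmulr_rgt0// pmulr_rgt0.
pose K t := t * F (x t) (y t).
pose K' t := F (x t) (y t) + t * ((b + 2 * c * x t) / y t * dx t + (2 * c - F (x t) (y t) / y t) * dy t).
have dK t : t \in `[1, E0] -> is_derive t 1 K (K' t).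
  move=> tE; have ? := dX t tE; have ? := dY t tE; have yt := y0 t tE.
  have ? : y t != 0 by rewrite gt_eqF.
  rewrite /K /F; apply: is_derive_eq.
  by rewrite /K' /F /GRing.scale/=; field.
have K'0 t : t \in `[1, E0] -> 0 <= K' t.
  move=> tE; have yt := y0 t tE; have Ft := Fpos (x t) _ yt.
  have t0 : 0 < t by move: tE; rewrite in_itv/= => /andP[+ _]; lra.
  have sp := speed t tE.
  rewrite /K'.
  set f := F _ _ in Ft *; set gx := (b + _) / _; set gy := 2 * c - _.
  have grad : y t ^+ 2 * (gx ^+ 2 + gy ^+ 2) = f ^+ 2.
    transitivity (f ^+ 2 + (b ^+ 2 - 4 * a * c)).
      by rewrite /gx /gy /f /F; field; rewrite gt_eqF.
    by rewrite disc; ring.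
  have CS : (gx * dx t + gy * dy t) ^+ 2 <= (gx ^+ 2 + gy ^+ 2) * (dx t ^+ 2 + dy t ^+ 2).
    by have := sqr_ge0 (gx * dy t - gy * dx t); nra.
  have : (t * (gx * dx t + gy * dy t)) ^+ 2 <= f ^+ 2.
    rewrite exprMn; apply: (le_trans (ler_wpM2l (sqr_ge0 t) CS)).
    rewrite -grad [leRHS]mulrC mulrCA ler_wpM2l ?addr_ge0 ?sqr_ge0//.
    by rewrite mulrC.
  rewrite -[leRHS]real_normK ?num_real// -[leLHS]real_normK ?num_real// ler_pXn2r ?nnegrE// (gtr0_norm Ft) ler_norml.
  by move=> /andP[+ _]; rewrite -subr_ge0 opprK addrC.
have KE : K 1 <= K E0.
  apply: (@ger0_derive1_ndecr _ K 1 E0 _ _ _ 1 E0 (lexx _) E01 (lexx _)).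
  - by move=> t /subset_itv_oo_cc tE; have [h _] := dK t tE; exact: h.
  - move=> t /subset_itv_oo_cc tE; rewrite derive1E; have [_ ->] := dK t tE.
    exact: K'0.
  - by apply: derivable_within_continuous => t tE; have [h _] := dK t tE; exact: h.
move: KE; rewrite /K -ex1 -ey1 -ex2 -ey2 FQ mul1r.
rewrite mulrCA ler_pMr//.
by rewrite ler_pdivlMr// mul1r.
Qed.

End curve.

(** * Geodesics in the parameter space *)

Section geodesic.
Variable R : realType.

(** The geodesic is found in the hyperboloid model, where a point (x, y) is
    the vector (1/y, x/y, (x^2 + y^2)/y) and a geodesic is
    (sinh(d - s) p + sinh(s) q) / sinh d.  With t = e^s and E = e^d its first two
    components are A and B below, positive combinations of those of p and q, so
    the curve stays in the region x > 0; moreover l = A^2 / 2 and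
    m = (A / B)^2. *)
Lemma ig_geodesic (x1 y1 x2 y2 E : R) : 0 < x1 -> 0 < y1 -> 0 < x2 -> 0 < y2 ->
  1 < E -> cosh_dist x1 y1 x2 y2 = (E + E^-1) / 2 ->
  exists m l dm dl : R -> R, [/\
    forall t, t \in `[1, E] -> [/\ is_derive t 1 m (dm t), is_derive t 1 l (dl t), 0 < m t, 0 < l t &
      l t / m t ^+ 3 * dm t ^+ 2 + (2 * l t ^+ 2)^-1 * dl t ^+ 2 = 2 / t ^+ 2],
    m 1 = x1 ^- 2, l 1 = (2 * y1 ^+ 2)^-1, m E = x2 ^- 2 & l E = (2 * y2 ^+ 2)^-1].
Proof.
move=> x10 y10 x20 y20 E1 GE; have E0 : 0 < E by lra.
pose D := E - E^-1.
have D0 : 0 < D by rewrite subr_gt0 (lt_trans _ E1)// invf_lt1.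
have E2 : 0 < E * E - 1 by nra.
pose A t := ((t - t^-1) / y2 + (E / t - t / E) / y1) / D.
pose B t := ((t - t^-1) * (x2 / y2) + (E / t - t / E) * (x1 / y1)) / D.
pose A' t := ((1 + t ^- 2) / y2 + (- E / t ^+ 2 - E^-1) / y1) / D.
pose B' t := ((1 + t ^- 2) * (x2 / y2) + (- E / t ^+ 2 - E^-1) * (x1 / y1)) / D.
have A1 : A 1 = y1^-1 by rewrite /A /D; field; rewrite !gt_eqF.
have B1 : B 1 = x1 / y1 by rewrite /B /D; field; rewrite !gt_eqF.
have AE : A E = y2^-1 by rewrite /A /D; field; rewrite !gt_eqF.
have BE : B E = x2 / y2 by rewrite /B /D; field; rewrite !gt_eqF.
have pos t (p q : R) : t \in `[1, E] -> 0 < p -> 0 < q -> 0 < (t - t^-1) * p + (E / t - t / E) * q.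
  rewrite in_itv/= => /andP[t1 tE] p0 q0; have t0 : 0 < t by lra.
  have u0 : 0 <= t - t^-1 by rewrite subr_ge0 (le_trans _ t1)// invf_le1.
  have v0 : 0 <= E / t - t / E.
    by rewrite subr_ge0 ler_pdivrMr// mulrAC ler_pdivlMr//; nra.
  have uv : 0 < (t - t^-1) + (E / t - t / E).
    have -> : (t - t^-1) + (E / t - t / E) = (E - 1) * (t ^+ 2 + E) / (t * E).
      by field; rewrite !gt_eqF.
    apply: divr_gt0; last exact: mulr_gt0.
    by apply: mulr_gt0; rewrite ?subr_gt0// addr_gt0// exprn_gt0.
  move: u0 uv; rewrite le_eqVlt => /predU1P[<-|u0 _].
    by rewrite mul0r !add0r => v1; exact: mulr_gt0.
  by rewrite ltr_pwDl ?mulr_gt0// mulr_ge0// ltW.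
have A0 t : t \in `[1, E] -> 0 < A t.
  by move=> tE; rewrite divr_gt0// pos// invr_gt0.
have B0 t : t \in `[1, E] -> 0 < B t.
  by move=> tE; rewrite divr_gt0// pos// divr_gt0.
exists (fun t => A t ^+ 2 / B t ^+ 2), (fun t => A t ^+ 2 / 2),
  (fun t => 2 * A t * (A' t * B t - A t * B' t) / B t ^+ 3), (fun t => A t * A' t).
split; last 4 first.
- by rewrite A1 B1; field; rewrite !gt_eqF.
- by rewrite A1; field; rewrite !gt_eqF.
- by rewrite AE BE; field; rewrite !gt_eqF.
- by rewrite AE; field; rewrite !gt_eqF.
move=> t tE; have At := A0 t tE; have Bt := B0 t tE.
have t0 : 0 < t by move: tE; rewrite in_itv/= => /andP[+ _]; lra.
have tn0 : t != 0 by rewrite gt_eqF.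
have Bn0 : B t ^+ 2 != 0 by rewrite gt_eqF// exprn_gt0.
have dV : is_derive t 1 (fun u : R => u^-1) (- t ^- 2).
  by apply: (is_derive_eq (is_deriveV tn0 (is_derive_id _ _))); rewrite /GRing.scale/= mulr1.
have dA : is_derive t 1 A (A' t).
  rewrite /A; apply: is_derive_eq.
  by rewrite /A' /GRing.scale/=; field; rewrite !gt_eqF.
have dB : is_derive t 1 B (B' t).
  rewrite /B; apply: is_derive_eq.
  by rewrite /B' /GRing.scale/=; field; rewrite !gt_eqF.
split.
- apply: is_derive_eq; rewrite /GRing.scale/=; field.
  by rewrite gt_eqF.
- by apply: is_derive_eq; rewrite /GRing.scale/=; field.
- by rewrite divr_gt0 ?exprn_gt0.
- by rewrite divr_gt0 ?exprn_gt0.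
(* The squares of W and of A' below add up to A^2 / t^2: this is unit speed. *)
have W : A' t * B t - A t * B' t = 2 * (x1 - x2) / (t * y1 * y2 * D).
  by rewrite /A /B /A' /B' /D; field; rewrite !gt_eqF.
have S : A t ^+ 2 - t ^+ 2 * A' t ^+ 2 = 4 * (x1 - x2) ^+ 2 / (D * y1 * y2) ^+ 2.
  transitivity (4 / D ^+ 2 * ((E + E^-1) / (y1 * y2) - y1 ^- 2 - y2 ^- 2)).
    by rewrite /A /A' /D; field; rewrite !gt_eqF.
  have -> : E + E^-1 = 2 * cosh_dist x1 y1 x2 y2 by rewrite GE; field; rewrite gt_eqF.
  by rewrite /cosh_dist; field; rewrite !gt_eqF.
transitivity (2 * ((A' t * B t - A t * B' t) ^+ 2 + A' t ^+ 2) / A t ^+ 2).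
  by field; rewrite !gt_eqF.
have -> : A' t ^+ 2 = (A t ^+ 2 - 4 * (x1 - x2) ^+ 2 / (D * y1 * y2) ^+ 2) / t ^+ 2.
  by rewrite -S; field.
by rewrite W; field; rewrite !gt_eqF.
Qed.

End geodesic.

(** * Isometries contract the hyperbolic distance *)

Section contraction.
Variable R : realType.
Implicit Types (f : ig_param R -> ig_param R).

(** The Jacobian of the inverse map is the inverse matrix, by the chain rule
    applied to a composition that is the identity near the given point. *)
Lemma riemannian_isometry_inv n (M : set 'rV[R]_n) (g : 'rV[R]_n -> 'M[R]_n)
    (f : M -> M) : open M -> riemannian_isometry g f ->
  exists h : M -> M, [/\ cancel f h, cancel h f & riemannian_isometry g h].
Proof.
move=> oM [h [fK hK sf sh df]].
exists h; split; [exact: fK|exact: hK|].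
exists f; split; [exact: hK|exact: fK|exact: sh|exact: sf|move=> x].
set F := valLR 0 f in sf df *; set H := valLR 0 h in sh *.
pose y := h x; have xE : x = f y by rewrite hK.
have My : M (val y) := set_mem (valP y).
have Mx : M (val x) := set_mem (valP x).
have dF : differentiable F (val y) := sf [::] _ My.
have dH : differentiable H (val x) := sh [::] _ Mx.
have FE : F (val y) = val x by rewrite /F valLR_val -xE.
have dHF : differentiable H (F (val y)) by rewrite FE.
have FH : 'J F (val y) *m 'J H (val x) = 1%:M.
  apply/row_matrixP => i; rewrite !rowE mulmx1 mulmxA.
  rewrite -deriveEjacobian// -deriveEjacobian// deriveE// deriveE//.
  rewrite -[in LHS]FE.
  rewrite -[LHS]/(('d H (F (val y)) \o 'd F (val y)) _) -diff_comp// -deriveE; last first.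
    exact: differentiable_comp.
  rewrite -[RHS](derive_id (val y)); apply: near_eq_derive.
  have := open_nbhs_nbhs (conj oM My); apply: filterS => u uM.
  by rewrite /comp -[u]/(val (SigSub (mem_set uM) : M)) /F valLR_val /H valLR_val fK.
have HF := mulmx1C FH.
rewrite -/y.
have := df y; rewrite -xE => <-.
by rewrite !mulmxA HF mul1mx -mulmxA -trmx_mul HF trmx1 mulmx1.
Qed.

Lemma open_ig_param : open (ig_param R).
Proof. by rewrite openE => t tP; exact: nbhs_ig_param. Qed.

(** The coordinates in which the Fisher metric is twice the metric of the
    upper half-plane. *)
Definition ig_x (t : 'rV[R]_2) := ig_mu t `^ (- 2^-1).
Definition ig_y (t : 'rV[R]_2) := (2 * ig_lambda t) `^ (- 2^-1).
Definition ig_cosh_dist (t u : 'rV[R]_2) := cosh_dist (ig_x t) (ig_y t) (ig_x u) (ig_y u).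

Lemma powRNhalf_sqr (a : R) : 0 < a -> (a `^ (- 2^-1)) ^+ 2 = a^-1.
Proof.
move=> a0; rewrite -powR_mulrn ?powR_ge0// -powRrM mulNr mulVf//.
by rewrite powR_inv1// ltW.
Qed.

Lemma powRNhalfE (a b : R) : 0 < a -> 0 < b -> a ^+ 2 = b^-1 -> b `^ (- 2^-1) = a.
Proof.
move=> a0 b0 ab; apply/eqP; rewrite -(@eqrXn2 _ 2)// ?(ltW a0) ?powR_ge0//.
by rewrite powRNhalf_sqr// ab.
Qed.

Lemma ig_x_gt0 t : ig_param R t -> 0 < ig_x t.
Proof. by move=> [m0 _]; exact: powR_gt0. Qed.
Lemma ig_y_gt0 t : ig_param R t -> 0 < ig_y t.
Proof. by move=> [_ l0]; apply: powR_gt0; rewrite mulr_gt0. Qed.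

Lemma ig_coords_inj t u : ig_param R t -> ig_param R u ->
  ig_x t = ig_x u -> ig_y t = ig_y u -> t = u.
Proof.
move=> [mt lt] [mu lu] ex ey; rewrite [LHS]row2_eta [RHS]row2_eta; congr row2.
  by move: (congr1 (fun z => z ^+ 2) ex); rewrite /ig_x !powRNhalf_sqr// => /invr_inj.
move: (congr1 (fun z => z ^+ 2) ey); rewrite /ig_y !powRNhalf_sqr ?mulr_gt0// => /invr_inj.
by apply: mulfI.
Qed.

Lemma cosh_dist_eq1 (x1 y1 x2 y2 : R) : 0 < y1 -> 0 < y2 ->
  cosh_dist x1 y1 x2 y2 = 1 -> x1 = x2 /\ y1 = y2.
Proof.
move=> y10 y20; move/(congr1 (fun z => z * (2 * y1 * y2))).
rewrite mul1r divfK ?gt_eqF ?mulr_gt0// => H.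
have : (x1 - x2) ^+ 2 + (y1 - y2) ^+ 2 = 0.
  transitivity ((x1 - x2) ^+ 2 + y1 ^+ 2 + y2 ^+ 2 - 2 * y1 * y2); first by ring.
  by rewrite H subrr.
move/eqP; rewrite paddr_eq0 ?sqr_ge0// !sqrf_eq0 !subr_eq0.
by move=> /andP[/eqP -> /eqP ->].
Qed.

Lemma is_derive_powRNhalf (k : R -> R) (t d : R) : 0 < k t -> is_derive t 1 k d ->
  is_derive t 1 (fun t => k t `^ (- 2^-1)) (- (k t `^ (- 2^-1) / (2 * k t)) * d).
Proof.
move=> k0 dk; have h := is_derive1_powR (- 2^-1) k0.
apply: (is_derive_eq (is_derive1_comp h dk)); congr (_ * _).
rewrite powRB; last by apply/implyP => _; rewrite gt_eqF.
by rewrite powRr1 ?(ltW k0)//; field; rewrite gt_eqF.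
Qed.

Lemma ord2_case (j : 'I_2) : j = 0 \/ j = 1.
Proof. by case: j => [[|[|//]] ?]; [left|right]; exact: val_inj. Qed.

Lemma ig_metric_quad (t w : 'rV[R]_2) : ig_param R t ->
  (w *m ig_metric t *m w^T) 0 0 =
  ig_lambda t / ig_mu t ^+ 3 * w 0 0 ^+ 2 + (2 * ig_lambda t ^+ 2)^-1 * w 0 1 ^+ 2.
Proof.
move=> tP; rewrite mxE sum_ord2 !mxE !sum_ord2 !(ig_metricE tP) /=; ring.
Qed.

Lemma quadratic_pullback m n (w : 'rV[R]_m) (J : 'M[R]_(m, n)) (G : 'M[R]_n) :
  w *m (J *m G *m J^T) *m w^T = (w *m J) *m G *m (w *m J)^T.
Proof. by rewrite trmx_mul !mulmxA. Qed.

(** The image under f of the geodesic from p to q has the speed of that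
    geodesic, so its ends are no further apart than p and q. *)
Lemma isometry_contracts f (p q : ig_param R) : ig_isometries R f ->
  ig_cosh_dist (val (f p)) (val (f q)) <= ig_cosh_dist (val p) (val q).
Proof.
move=> [h [_ _ sf _ df]].
have pP := ig_paramP p; have qP := ig_paramP q.
have [E E1 GE] := cosh_exp_surj (cosh_dist_ge1 (ig_x (val p)) (ig_x (val q)) (ig_y_gt0 pP) (ig_y_gt0 qP)).
move: E1; rewrite le_eqVlt => /predU1P[E1|E1].
  have id1 (x y : R) : 0 < y -> cosh_dist x y x y = 1.
    by move=> y0; rewrite /cosh_dist; field; rewrite gt_eqF.
  have [ex ey] : ig_x (val p) = ig_x (val q) /\ ig_y (val p) = ig_y (val q).
    apply: cosh_dist_eq1; [exact: ig_y_gt0|exact: ig_y_gt0|].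
    by rewrite GE -E1 invr1; field.
  have -> : p = q by apply/val_inj; exact: ig_coords_inj.
  by rewrite /ig_cosh_dist !id1 ?ig_y_gt0//; exact: ig_paramP.
have [m [l [dm [dl [geo m1 l1 mE lE]]]]] := ig_geodesic (ig_x_gt0 pP) (ig_y_gt0 pP) (ig_x_gt0 qP) (ig_y_gt0 qP) E1 GE.
rewrite [leRHS]GE.
pose c t : 'rV[R]_2 := row2 (m t) (l t).
have cP t : t \in `[1, E] -> ig_param R (c t).
  by move=> /geo[_ _ m0 l0 _]; split; rewrite /ig_mu /ig_lambda !mxE.
pose F := valLR 0 f.
have dc t : t \in `[1, E] -> is_derive t 1 c (row2 (dm t) (dl t)).
  move=> /geo[[dm' dmE] [dl' dlE] _ _ _].
  have c0 i : (fun u => c u i 0) = m by apply/funext => u; rewrite mxE.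
  have c1 i : (fun u => c u i 1) = l by apply/funext => u; rewrite mxE.
  have dc : derivable c t 1.
    apply/derivable_mxP => i j; have [->|->] := ord2_case j.
      rewrite c0; exact: dm'.
    rewrite c1; exact: dl'.
  split; first exact: dc.
  rewrite derive_mx; last exact: dc.
  apply/rowP => j; rewrite !mxE; have [->|->] := ord2_case j; first by rewrite c0 dmE.
  by rewrite c1 dlE.
(* The velocity of the image curve. *)
pose w t := row2 (dm t) (dl t) *m 'J F (c t).
have dFc t : t \in `[1, E] -> is_derive t 1 (F \o c) (w t).
  move=> tE; have [c' cE] := dc t tE.
  have dF : differentiable F (c t) := sf [::] _ (cP t tE).
  have dct : differentiable c t by exact/derivable1_diffP.
  have dFc : differentiable (F \o c) t by exact: differentiable_comp.
  split; first exact/derivable1_diffP.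
  rewrite deriveE// diff_comp//= -(deriveE _ dct) cE.
  by rewrite -deriveE// deriveEjacobian.
have FP t : t \in `[1, E] -> ig_param R (F (c t)).
  move=> tE; rewrite -[c t]/(val (SigSub (mem_set (cP t tE)) : ig_param R)).
  by rewrite /F valLR_val; exact: ig_paramP.
pose M t := ig_mu (F (c t)); pose L t := ig_lambda (F (c t)).
have comp t i : t \in `[1, E] -> is_derive t 1 (fun t => F (c t) 0 i) (w t 0 i).
  move=> /dFc[d1 dE]; split; first exact: ((derivable_mxP _ _ _).1 d1 0 i).
  by rewrite -dE derive_mx// mxE.
have endp u (uP : ig_param R (val u)) t : c t = val u -> F (c t) = val (f u).
  by move=> ->; rewrite /F valLR_val.
have in1 : 1 \in `[1, E] by rewrite in_itv/= lexx ltW.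
have inE : E \in `[1, E] by rewrite in_itv/= lexx ltW.
have c1 : c 1 = val p.
  rewrite [RHS]row2_eta /c; have [m0 l0] := pP; congr row2.
    by rewrite m1 powRNhalf_sqr// invrK.
  by rewrite l1 powRNhalf_sqr ?mulr_gt0// /ig_lambda; field; rewrite gt_eqF.
have cE : c E = val q.
  rewrite [RHS]row2_eta /c; have [m0 l0] := qP; congr row2.
    by rewrite mE powRNhalf_sqr// invrK.
  by rewrite lE powRNhalf_sqr ?mulr_gt0// /ig_lambda; field; rewrite gt_eqF.
have := @cosh_dist_curve R (fun t => ig_x (F (c t))) (fun t => ig_y (F (c t)))
  (fun t => - (ig_x (F (c t)) / (2 * M t)) * w t 0 0)
  (fun t => - (ig_y (F (c t)) / (2 * (2 * L t))) * (2 * w t 0 1)) E (ltW E1).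
rewrite -/(ig_cosh_dist _ _) (endp p pP 1 c1) (endp q qP E cE); apply.
- move=> t tE; apply: is_derive_powRNhalf (comp t 0 tE).
  by have [] := FP t tE.
- move=> t tE; have [_ l0] := FP t tE.
  apply: (@is_derive_powRNhalf (fun t => 2 * ig_lambda (F (c t)))); first by rewrite mulr_gt0.
  have := comp t 1 tE; rewrite -/(ig_lambda _) => dlt.
  by apply: is_derive_eq; rewrite /GRing.scale/=; ring.
- by move=> t tE; exact: ig_y_gt0 (FP t tE).
move=> t tE; have [m0 l0] := FP t tE; have [_ _ m0' l0' sp] := geo t tE.
have t0 : 0 < t by move: tE; rewrite in_itv/= => /andP[+ _]; lra.
pose u : ig_param R := SigSub (mem_set (cP t tE)).
have fuE : val (f u) = F (c t) by rewrite /F -[c t]/(val u) valLR_val.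
have H : (w t *m ig_metric (F (c t)) *m (w t)^T) 0 0 =
    (row2 (dm t) (dl t) *m ig_metric (c t) *m (row2 (dm t) (dl t))^T) 0 0.
  by rewrite -[in RHS](df u) fuE quadratic_pullback.
rewrite (ig_metric_quad _ (FP t tE)) (ig_metric_quad _ (cP t tE)) in H.
have cm : ig_mu (c t) = m t by rewrite /ig_mu mxE.
have cl : ig_lambda (c t) = l t by rewrite /ig_lambda mxE.
rewrite cm cl in H.
have e0 : row2 (dm t) (dl t) 0 0 = dm t by rewrite mxE.
have e1 : row2 (dm t) (dl t) 0 1 = dl t by rewrite mxE.
rewrite e0 e1 [RHS]sp -/(M t) -/(L t) in H.
rewrite -/(M t) -/(L t) in m0 l0.
have x2 : ig_x (F (c t)) ^+ 2 = (M t)^-1 by rewrite powRNhalf_sqr.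
have y2 : ig_y (F (c t)) ^+ 2 = (2 * L t)^-1 by rewrite powRNhalf_sqr// mulr_gt0.
rewrite le_eqVlt; apply/orP; left; apply/eqP.
transitivity (t ^+ 2 * ig_y (F (c t)) ^+ 2 * 
  (L t / M t ^+ 3 * w t 0 0 ^+ 2 + (2 * L t ^+ 2)^-1 * w t 0 1 ^+ 2) / 2).
  rewrite !(exprMn, sqrrN) x2 y2.
  by field; rewrite !gt_eqF.
by rewrite H; field; rewrite gt_eqF.
Qed.

End contraction.

(** * Rigidity *)

Section rigidity.
Variable R : realType.
Implicit Types (f : ig_param R -> ig_param R).

Lemma ig_isometry_inv f : ig_isometries R f ->
  exists h, [/\ cancel f h, cancel h f & ig_isometries R h].
Proof. exact: riemannian_isometry_inv (@open_ig_param R). Qed.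

Lemma isometry_cosh_dist f (p q : ig_param R) : ig_isometries R f ->
  ig_cosh_dist (val (f p)) (val (f q)) = ig_cosh_dist (val p) (val q).
Proof.
move=> If; have [h [fK _ Ih]] := ig_isometry_inv If.
apply/eqP; rewrite eq_le (isometry_contracts p q If)/=.
by have := isometry_contracts (f p) (f q) Ih; rewrite !fK.
Qed.

Lemma ig_point (x y : R) : 0 < x -> 0 < y ->
  exists p : ig_param R, ig_x (val p) = x /\ ig_y (val p) = y.
Proof.
move=> x0 y0; have P : ig_param R (row2 (x ^- 2) ((2 * y ^+ 2)^-1)).
  by split; rewrite /ig_mu /ig_lambda mxE/= invr_gt0 ?mulr_gt0 ?exprn_gt0.
exists (SigSub (mem_set P)); split.
  rewrite /ig_x/= /ig_mu mxE/=.
  by apply: powRNhalfE; rewrite ?invr_gt0 ?exprn_gt0// invrK.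
rewrite /ig_y/= /ig_lambda mxE/=.
have -> : 2 * (2 * y ^+ 2)^-1 = y ^- 2 by field; rewrite gt_eqF.
by apply: powRNhalfE; rewrite ?invr_gt0 ?exprn_gt0// invrK.
Qed.

(** Points running to infinity or to the origin give the signs of c and a.
    Then b^2 = 1 + 4 a c >= 1, and a negative b would give the form a
    nonpositive value at some point. *)
Lemma positive_quadratic (a b c : R) : b ^+ 2 - 4 * a * c = 1 ->
  (forall x y : R, 0 < x -> 0 < y -> 0 < a + b * x + c * (x ^+ 2 + y ^+ 2)) ->
  [/\ 0 <= a, 1 <= b & 0 <= c].
Proof.
move=> disc pos.
have c0 : 0 <= c.
  rewrite leNgt; apply/negP => c0; pose x := 1 + (`|a| + `|b|) / - c.
  have nc : 0 < - c by rewrite oppr_gt0.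
  have x1 : 1 <= x by rewrite lerDl divr_ge0 ?addr_ge0// ltW.
  have xc : `|a| + `|b| <= x * - c.
    by rewrite /x mulrDl mul1r divfK ?gt_eqF// lerDr ltW.
  have x0 : 0 < x by lra.
  have := pos x x x0 x0.
  have ha := ler_norm a; have hb := ler_norm b; have := normr_ge0 a.
  have : b * x <= `|b| * x by rewrite ler_wpM2r// ltW.
  have : `|a| <= `|a| * x by rewrite ler_peMr.
  have : (`|a| + `|b|) * x <= x * - c * x by rewrite ler_wpM2r// ltW.
  have : 0 < - c * x ^+ 2 by rewrite mulr_gt0// exprn_gt0.
  by nra.
have a0 : 0 <= a.
  rewrite leNgt; apply/negP => a0; pose d := `|b| + 2 * c + - a + 1.
  have na : 0 < - a by rewrite oppr_gt0.
  have d0 : 0 < d by have := normr_ge0 b; rewrite /d; lra.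
  pose x := - a / d.
  have x0 : 0 < x by rewrite divr_gt0.
  have xd : x * d = - a by rewrite /x divfK ?gt_eqF.
  have x1 : x <= 1 by rewrite ler_pdivrMr// mul1r /d; have := normr_ge0 b; lra.
  have := pos x x x0 x0.
  have : b * x <= `|b| * x by rewrite ler_wpM2r ?ler_norm// ltW.
  have : c * x ^+ 2 <= c * x by rewrite ler_wpM2l// expr2 ler_piMr// ltW.
  have : 0 < x * (- a + 1) by rewrite mulr_gt0//; lra.
  by move: xd; rewrite /d; nra.
have b2 : 1 <= b ^+ 2.
  by rewrite -disc lerBlDr lerDl !mulr_ge0.
split=> //; have [b0|b0] := lerP 0 b.
  by rewrite -(ler_pXn2r (ltn0Sn 1)) ?nnegrE// expr1n.
exfalso; move: c0; rewrite le_eqVlt => /predU1P[c0|c0].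
  have := pos (a + 1) 1 (ltr_pwDr ltr01 a0) ltr01.
  have b1 : b ^+ 2 = 1 by rewrite -disc -c0; ring.
  have : b = -1 by apply/eqP; move/eqP: b1; rewrite sqrf_eq1 => /orP[/eqP b1|//]; lra.
  by move=> ->; rewrite -c0; lra.
have := pos (- b / (2 * c)) (2 * c)^-1.
rewrite divr_gt0 ?oppr_gt0 ?mulr_gt0// invr_gt0 mulr_gt0// => /(_ isT isT).
have -> : a + b * (- b / (2 * c)) + c * ((- b / (2 * c)) ^+ 2 + (2 * c)^-1 ^+ 2) =
  (1 - (b ^+ 2 - 4 * a * c)) / (4 * c) by field; rewrite gt_eqF.
by rewrite disc subrr mul0r ltxx.
Qed.

(** With a point (x, y) written as the vector (1/y, x/y, (x^2 + y^2)/y), cosh d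
    is a Lorentz form B, and x/y is the combination of B(., p_i), for the points
    p_i = (i, 1) with i = 1, 2, 3, with coefficients 5/2, -4, 3/2.  Since f
    preserves B, the function x/y o f is the same combination of the
    B(., f^-1 p_i), hence of the form (a + b x + c (x^2 + y^2)) / y, and
    b^2 - 4 a c = 1 because the Gram matrix of the points is preserved.  As it
    is positive at all points, it is at least x/y. *)
Lemma isometry_slope_le f (p : ig_param R) : ig_isometries R f ->
  ig_x (val p) / ig_y (val p) <= ig_x (val (f p)) / ig_y (val (f p)).
Proof.
move=> If; have [h [fK hK Ih]] := ig_isometry_inv If.
have [p1 [x1 y1]] := ig_point ltr01 ltr01.
have [p2 [x2 y2]] := ig_point (ltr0Sn R 1) ltr01.
have [p3 [x3 y3]] := ig_point (ltr0Sn R 2) ltr01.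
have cyn0 (q : ig_param R) : ig_y (val q) != 0 by rewrite gt_eqF// ig_y_gt0//; exact: ig_paramP.
have D i j : ig_cosh_dist (val (h i)) (val (h j)) = ig_cosh_dist (val i) (val j) by exact: isometry_cosh_dist.
have Df q i : ig_cosh_dist (val (f q)) (val i) = ig_cosh_dist (val q) (val (h i)).
  by rewrite -[i in LHS]hK isometry_cosh_dist.
have d12 := D p1 p2; have d13 := D p1 p3; have d23 := D p2 p3.
have Df1 q := Df q p1; have Df2 q := Df q p2; have Df3 q := Df q p3.
rewrite /ig_cosh_dist ?x1 ?y1 ?x2 ?y2 ?x3 ?y3 in d12 d13 d23 Df1 Df2 Df3.
have n1 := cyn0 (h p1); have n2 := cyn0 (h p2); have n3 := cyn0 (h p3).
move: (ig_x (val (h p1))) (ig_x (val (h p2))) (ig_x (val (h p3)))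
      (ig_y (val (h p1))) (ig_y (val (h p2))) (ig_y (val (h p3)))
  n1 n2 n3 d12 d13 d23 Df1 Df2 Df3 => a1 a2 a3 b1 b2 b3 n1 n2 n3 d12 d13 d23 Df1 Df2 Df3.
pose c := 5 / (4 * b1) - 2 / b2 + 3 / (4 * b3).
pose b := - 5 / 2 * (a1 / b1) + 4 * (a2 / b2) - 3 / 2 * (a3 / b3).
pose a := 5 * (a1 ^+ 2 + b1 ^+ 2) / (4 * b1) - 2 * (a2 ^+ 2 + b2 ^+ 2) / b2 + 3 * (a3 ^+ 2 + b3 ^+ 2) / (4 * b3).
have slope q : ig_x (val (f q)) / ig_y (val (f q)) =
    (a + b * ig_x (val q) + c * (ig_x (val q) ^+ 2 + ig_y (val q) ^+ 2)) / ig_y (val q).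
  transitivity (5 / 2 * cosh_dist (ig_x (val (f q))) (ig_y (val (f q))) 1 1
    - 4 * cosh_dist (ig_x (val (f q))) (ig_y (val (f q))) 2 1
    + 3 / 2 * cosh_dist (ig_x (val (f q))) (ig_y (val (f q))) 3 1).
    by rewrite /cosh_dist; field; exact: cyn0.
  rewrite Df1 Df2 Df3 /cosh_dist /a /b /c; field.
  by rewrite n1 n2 n3 cyn0.
have disc : b ^+ 2 - 4 * a * c = 1.
  transitivity (- (25 / 4 + 16 + 9 / 4 - 20 * cosh_dist a1 b1 a2 b2 + 15 / 2 * cosh_dist a1 b1 a3 b3 - 12 * cosh_dist a2 b2 a3 b3)).
    by rewrite /cosh_dist /a /b /c; field; rewrite n1 n2 n3.
  by rewrite d12 d13 d23 /cosh_dist; field.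
clearbody a b c.
have [|a0 bge1 c0] := positive_quadratic disc.
  move=> x y x0 y0; have [q [qx qy]] := ig_point x0 y0.
  have := divr_gt0 (ig_x_gt0 (ig_paramP (f q))) (ig_y_gt0 (ig_paramP (f q))).
  by rewrite slope qx qy pmulr_lgt0// invr_gt0.
have x0 := ig_x_gt0 (ig_paramP p); have y0 := ig_y_gt0 (ig_paramP p).
rewrite slope ler_pM2r ?invr_gt0//.
have bx : ig_x (val p) <= b * ig_x (val p) by rewrite ler_peMl// ltW.
have cr : 0 <= c * (ig_x (val p) ^+ 2 + ig_y (val p) ^+ 2) by rewrite mulr_ge0 ?addr_ge0 ?sqr_ge0.
by rewrite -[leLHS]addr0 lerD// -[leLHS]add0r lerD.
Qed.

Lemma isometry_slope f (p : ig_param R) : ig_isometries R f ->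
  ig_x (val (f p)) / ig_y (val (f p)) = ig_x (val p) / ig_y (val p).
Proof.
move=> If; have [h [fK _ Ih]] := ig_isometry_inv If.
apply/eqP; rewrite eq_le (isometry_slope_le p If) andbT.
by have := isometry_slope_le (f p) Ih; rewrite fK.
Qed.

Lemma ig_radius2E t : ig_param R t -> ig_radius2 t = ig_x t ^+ 2 + ig_y t ^+ 2.
Proof. by move=> [m0 l0]; rewrite !powRNhalf_sqr ?mulr_gt0. Qed.

(** Once the slopes s and t of p and q are fixed, cosh d only depends on the
    ratio of their radii up to inversion: its preservation factors into the two
    alternatives. *)
Lemma isometry_radius2 f (p q : ig_param R) : ig_isometries R f ->
  ig_radius2 (val (f p)) * ig_radius2 (val q) = ig_radius2 (val (f q)) * ig_radius2 (val p) \/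
  ig_radius2 (val (f p)) * ig_radius2 (val p) = ig_radius2 (val (f q)) * ig_radius2 (val q).
Proof.
move=> If; have := isometry_cosh_dist p q If.
have := isometry_slope p If; have := isometry_slope q If.
rewrite !ig_radius2E; try exact: ig_paramP.
have := ig_y_gt0 (ig_paramP (f p)); have := ig_y_gt0 (ig_paramP (f q)).
have := ig_y_gt0 (ig_paramP p); have := ig_y_gt0 (ig_paramP q).
rewrite /ig_cosh_dist; move: (ig_x (val (f p))) (ig_x (val (f q))) (ig_x (val p)) (ig_x (val q))
  (ig_y (val (f p))) (ig_y (val (f q))) (ig_y (val p)) (ig_y (val q)).
move=> xY xZ xy xz Y Z y z z0 y0 Z0 Y0 sq sp.
have [s sE] : exists s, s = xy / y by exists (xy / y).
have [t tE] : exists t, t = xz / z by exists (xz / z).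
have -> : xy = s * y by rewrite sE divfK// gt_eqF.
have -> : xz = t * z by rewrite tE divfK// gt_eqF.
have -> : xY = s * Y by rewrite sE -sp divfK// gt_eqF.
have -> : xZ = t * Z by rewrite tE -sq divfK// gt_eqF.
move=> /eqP; rewrite -subr_eq0.
have -> : cosh_dist (s * Y) Y (t * Z) Z - cosh_dist (s * y) y (t * z) z =
  (Y * z - y * Z) * ((1 + s ^+ 2) * Y * y - (1 + t ^+ 2) * Z * z) / (2 * Y * Z * y * z).
  by rewrite /cosh_dist; field; rewrite !gt_eqF.
rewrite mulf_eq0 invr_eq0 [X in _ || X]gt_eqF ?mulr_gt0// orbF mulf_eq0 !subr_eq0.
move=> /orP[/eqP E|/eqP E]; [left|right].
  transitivity ((1 + s ^+ 2) * (1 + t ^+ 2) * (Y * z) ^+ 2); first by ring.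
  by rewrite E; ring.
transitivity (((1 + s ^+ 2) * Y * y) ^+ 2); first by ring.
by rewrite E; ring.
Qed.

(** The slope fixes the ratio lambda / mu, so it fixes the parameter up to a
    factor, which radius2 detects. *)
Lemma ig_same_slope t u : ig_param R t -> ig_param R u ->
  ig_x t / ig_y t = ig_x u / ig_y u -> u = (ig_radius2 t / ig_radius2 u) *: t.
Proof.
move=> tP uP /(congr1 (fun z => z ^+ 2)); have [mt lt] := tP; have [mu lu] := uP.
rewrite !expr_div_n !powRNhalf_sqr ?mulr_gt0// !invrK => E.
have e : ig_lambda t = ig_mu t * ig_lambda u / ig_mu u.
  apply: (@mulfI _ (2 / ig_mu t)); first by rewrite gt_eqF// divr_gt0.
  transitivity ((ig_mu t)^-1 * (2 * ig_lambda t)); first by ring.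
  by rewrite E; field; rewrite !gt_eqF.
have d : 0 < 2 * ig_lambda u + ig_mu u by rewrite addr_gt0// mulr_gt0.
rewrite [LHS]row2_eta [RHS]row2_eta; congr row2.
  by rewrite -[LHS]/(ig_mu u) -[RHS]/(ig_mu _) ig_muZ /ig_radius2 e; field; rewrite !gt_eqF.
by rewrite -[LHS]/(ig_lambda u) -[RHS]/(ig_lambda _) ig_lambdaZ /ig_radius2 e; field; rewrite !gt_eqF.
Qed.

Lemma ig_point_radius2 (r : R) : 0 < r -> exists p : ig_param R, ig_radius2 (val p) = r.
Proof.
move=> r0; have s0 : 0 < Num.sqrt (r / 2) by rewrite sqrtr_gt0 divr_gt0.
have [p [px py]] := ig_point s0 s0; exists p.
rewrite ig_radius2E ?px ?py; last exact: ig_paramP.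
by rewrite sqr_sqrtr ?divr_ge0 ?ltW//; field.
Qed.

(** By isometry_radius2, log radius2 is transformed by an isometry of the real
    line.  Its values at radius2 = 1 and radius2 = 2 tell whether this is a
    translation or a reflection, for all points simultaneously. *)
Lemma isometry_rescale f : ig_isometries R f -> exists a e, f = ig_rescale a e.
Proof.
move=> If; have rel := isometry_radius2 _ _ If.
have pos (p : ig_param R) : 0 < ig_radius2 (val p) by exact: ig_radius2_gt0 (ig_paramP p).
have [p1 r1] := ig_point_radius2 ltr01.
have [p2 r2] := ig_point_radius2 (ltr0Sn R 1).
pose A := ig_radius2 (val (f p1)).
have A0 : 0 < A by exact: pos.
have fE q : val (f q) = (ig_radius2 (val q) / ig_radius2 (val (f q))) *: val q.
  apply: ig_same_slope; [exact: ig_paramP|exact: ig_paramP|].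
  by rewrite isometry_slope.
have rel1 q := rel p1 q; have rel2 q := rel p2 q.
have rel12 := rel1 p2.
rewrite r2 r1 !mulr1 -/A in rel12.
case: rel12 => [rel12|rel12].
  have fr q : ig_radius2 (val (f q)) = A * ig_radius2 (val q).
    have := rel1 q; have := rel2 q; have := pos q; have := pos (f q).
    rewrite r1 r2 -/A -rel12 !mulr1.
    move: (ig_radius2 (val (f q))) (ig_radius2 (val q)) => B b B0 b0 [H2|H2] [H1|H1] //; lra.
  exists (- ln A), false; apply/funext => q; apply: val_inj.
  rewrite [LHS]fE val_ig_rescale fr /ig_factor mulr1 expRN lnK ?posrE//.
  by congr (_ *: _); field; rewrite !gt_eqF.
have fr q : ig_radius2 (val (f q)) = A / ig_radius2 (val q).
  have := rel1 q; have := rel2 q; have := pos q; have := pos (f q).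
  have -> : ig_radius2 (val (f p2)) = A / 2 by rewrite rel12; field.
  rewrite r1 r2 -/A !mulr1.
  move: (ig_radius2 (val (f q))) (ig_radius2 (val q)) => B b B0 b0 H2 H1.
  suff -> : A = B * b by rewrite mulfK// gt_eqF.
  by case: H1 H2 => H1 [H2|H2] //; lra.
exists (- ln A), true; apply/funext => q; apply: val_inj.
rewrite [LHS]fE val_ig_rescale fr /ig_factor expRN lnK ?posrE//.
by congr (_ *: _); field; rewrite !gt_eqF.
Qed.

Lemma powRNhalfM (k a : R) : 0 < k -> 0 < a ->
  (k ^- 2 * a) `^ (- 2^-1) = k * a `^ (- 2^-1).
Proof.
move=> k0 a0; apply: powRNhalfE; rewrite ?mulr_gt0 ?powR_gt0 ?invr_gt0 ?exprn_gt0//.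
by rewrite exprMn powRNhalf_sqr// invfM invrK.
Qed.

Lemma ig_coordE (t : ig_param R) : ig_coord t = row2 (ig_x (val t)) (ig_y (val t)).
Proof. by []. Qed.

Lemma ig_coord_inj : injective (@ig_coord R).
Proof.
move=> t u; rewrite !ig_coordE => E; apply: val_inj; apply: ig_coords_inj.
- exact: ig_paramP.
- exact: ig_paramP.
- by have := congr1 (fun M : 'rV_2 => M 0 0) E; rewrite !mxE.
- by have := congr1 (fun M : 'rV_2 => M 0 1) E; rewrite !mxE.
Qed.

Lemma ig_coordZ (k : R) (t u : ig_param R) : 0 < k -> val u = k ^- 2 *: val t ->
  ig_coord u = k *: ig_coord t.
Proof.
move=> k0 E; have [m0 l0] := ig_paramP t; rewrite !ig_coordE E.
apply/rowP => i; rewrite !mxE; have [->|->] := ord2_case i => /=.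
  by rewrite /ig_x ig_muZ powRNhalfM.
by rewrite /ig_y ig_lambdaZ mulrCA powRNhalfM// mulr_gt0.
Qed.

Lemma ig_dilation_rescale f : ig_dilations R f <-> exists a, f = ig_rescale a false.
Proof.
have key (k : R) t : 0 < k -> ig_coord (ig_rescale (- 2 * ln k) false t) = k *: ig_coord t.
  move=> k0; apply: ig_coordZ => //; rewrite val_ig_rescale /ig_factor mulr1; congr (_ *: _).
  by rewrite mulNr expRN mulrC expRM_natr lnK.
split=> [[k k0 fE]|[a ->]].
  exists (- 2 * ln k); apply/funext => t; apply: ig_coord_inj.
  by rewrite fE key.
exists (expR (- a / 2)); first exact: expR_gt0.
move=> t; rewrite -(key _ _ (expR_gt0 _)) expRK.
by have -> : - 2 * (- a / 2) = a by field.
Qed.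

Lemma ig_inversion_rescale f : ig_inversions R f <-> exists a, f = ig_rescale a true.
Proof.
have key (k : R) t : 0 < k -> ig_coord (ig_rescale (- 4 * ln k) true t) = inversion k (ig_coord t).
  move=> k0; have tP := ig_paramP t; have r0 := ig_radius2_gt0 tP.
  have rE : \sum_i ig_coord t 0 i ^+ 2 = ig_radius2 (val t).
    by rewrite sum_ord2 ig_radius2E// ig_coordE !mxE.
  rewrite /inversion rE.
  apply: ig_coordZ; first by rewrite divr_gt0// exprn_gt0.
  rewrite val_ig_rescale /ig_factor; congr (_ *: _).
  rewrite mulNr expRN [4 * _]mulrC expRM_natr lnK//.
  by field; rewrite !gt_eqF.
split=> [[k k0 fE]|[a ->]].
  exists (- 4 * ln k); apply/funext => t; apply: ig_coord_inj.
  by rewrite fE key.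
exists (expR (- a / 4)); first exact: expR_gt0.
move=> t; rewrite -(key _ _ (expR_gt0 _)) expRK.
by have -> : - 4 * (- a / 4) = a by field.
Qed.

(** A point with radius2 = 1 detects the constant, and then a point with
    radius2 = 2 detects the reflection. *)
Lemma ig_rescale_inj a b e e' : ig_rescale a e = ig_rescale b e' -> a = b :> R /\ e = e'.
Proof.
move=> E; have fac (p : ig_param R) : ig_factor a e (val p) = ig_factor b e' (val p).
  have [m0 _] := ig_paramP p.
  have := congr1 (fun f => ig_mu (val (f p))) E.
  rewrite !val_ig_rescale !ig_muZ; apply: mulIf; by rewrite gt_eqF.
have [p1 r1] := ig_point_radius2 ltr01.
have [p2 r2] := ig_point_radius2 (ltr0Sn R 1).
have ab : a = b.
  apply: expR_inj; have := fac p1; rewrite /ig_factor r1 expr1n.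
  by rewrite !if_same !mulr1.
split=> //; have := fac p2; rewrite /ig_factor r2 ab => /(mulfI (lt0r_neq0 (expR_gt0 b))).
by case: e {E fac}; case: e' => //; lra.
Qed.

End rigidity.

Theorem theorem12 (R : realType) :
  ig_isometries R = generated_group (ig_dilations R `|` ig_inversions R) /\
  exists Phi : dihedral R -> (ig_param R -> ig_param R),
    [/\ injective Phi,
        range Phi = ig_isometries R &
        {morph Phi : x y / (x * y)%g >-> x \o y}].
Proof.
have isoE : ig_isometries R = [set f | exists a e, f = ig_rescale a e].
  apply/seteqP; split=> f /=; first exact: isometry_rescale.
  by move=> [a [e ->]]; exact: ig_rescale_isometry.
split.
  rewrite isoE; apply/seteqP; split=> f /=.
    move=> [a [[] ->]]; apply: generated_in; [right|left].
      by apply/ig_inversion_rescale; exists a.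
    by apply/ig_dilation_rescale; exists a.
  elim=> [g [/ig_dilation_rescale[a ->]|/ig_inversion_rescale[a ->]]|
          |g h _ [a [e ->]] _ [b [e' ->]]|g h gh hg _ [a [e ge]]].
  - by exists a, false.
  - by exists a, true.
  - by exists 0, false; rewrite ig_rescale0.
  - by eexists _, _; exact: ig_rescale_comp.
  - exists (if e then a else - a), e; apply/funext => t.
    rewrite -[RHS]gh ge -[ig_rescale a e _]/((ig_rescale a e \o ig_rescale _ e) t).
    rewrite ig_rescale_comp addbb.
    rewrite (_ : _ + _ = 0) ?ig_rescale0//; case: (e); ring.
(* Scaling the coordinates by exp v multiplies mu and lambda by exp (- 2 v). *)
exists (fun x => ig_rescale (- 2 * x.1) x.2); split.
- move=> [v e] [w e'] /= /ig_rescale_inj[/mulfI vw ->]; congr (_, _).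
  by apply: vw; rewrite oppr_eq0 pnatr_eq0.
- rewrite isoE; apply/seteqP; split=> f /=.
    by move=> [[v e] _ <-]; eexists _, _.
  by move=> [a [e ->]]; exists (- a / 2, e) => //=; congr (ig_rescale _ _); field.
- move=> [v e] [w e']; rewrite ig_rescale_comp; congr (ig_rescale _ _).
  by rewrite /=; case: e => /=; ring.
Qed.
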